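(* Let $l>2$ and $m>1$ be integers. Then the quotient complex $\Delta(B_{lm})/S_l\wr S_m$ is not Cohen-Macaulay over $\mathbb{Z}/2\mathbb{Z}$, and consequently the ring of invariants $(\mathbb{Z}/2\mathbb{Z})[x_1,\dots,x_{lm}]^{S_l\wr S_m}$ is not a Cohen-Macaulay ring.
   Context: $B_n$ is the Boolean algebra of all subsets of $\{1,\dots,n\}$ ordered by inclusion, and $\Delta(B_n)$ is the simplicial complex whose faces are the chains $u_0<\dots<u_i$ of elements of $B_n\setminus\{\emptyset,\{1,\dots,n\}\}$ (the empty chain being the empty face). The wreath product $S_l\wr S_m\subset S_{lm}$ is the subgroup of order $(l!)^m m!$ consisting of the permutations of $\{1,\dots,lm\}$ that preserve the partition of $\{1,\dots,lm\}$ into the $m$ sets (''rows'') $\{il+1,\dots,(i+1)l\}$, $0\le i<m$; that is, it permutes the elements within each row and permutes the rows wholesale. It acts on $B_{lm}$, hence on $\Delta(B_{lm})$, and on the polynomial ring $k[x_1,\dots,x_{lm}]$ by permuting the subscripts of the variables. The quotient complex $\Delta(B_{lm})/S_l\wr S_m$ is the regular cell complex whose cells (faces) are the $S_l\wr S_m$-orbits of faces of $\Delta(B_{lm})$, with an orbit contained in another if some representative of the first is contained in a representative of the second. (It is in general not the order complex of the quotient poset.) It is a boolean cell complex: every lower interval in its face poset, which includes the empty face, is a Boolean algebra. The link $\mathrm{lk}(F)$ of a face $F$ is the boolean cell complex whose face poset (including the empty face, which corresponds to $F$) is $\{H : H\supseteq F\}$. A boolean cell complex is Cohen-Macaulay over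 a field $k$ if for every face $F$ (including the empty face) the reduced homology $\tilde H_i(\mathrm{lk}(F);k)$ vanishes for all $i<\dim \mathrm{lk}(F)$. *)

(* Defs.v *)
From HB Require Import structures.
From mathcomp Require Import all_boot all_order all_algebra all_fingroup.
From mathcomp.multinomials Require Import mpoly.

Set Implicit Arguments.
Unset Strict Implicit.
Unset Printing Implicit Defensive.

Import Order.TTheory GRing.Theory.

Local Open Scope order_scope.

(* Boolean cell complexes are represented by their face posets, \bot being the
   empty face. *)

Section BooleanCellComplex.
Context {d : Order.disp_t}.
Implicit Type T : finBPOrderType d.

Definition boolean_cell_complex T : Prop :=
  forall H : T, exists (n : nat) (f : {set 'I_n} -> T),
    (forall A B : {set 'I_n}, (f A <= f B) = (A \subset B)) /\
    (forall K : T, K <= H <-> exists A, f A = K).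

Definition vertex T (v : T) : bool :=
  (v != \bot) && [forall w : T, (w < v) ==> (w == \bot)].

Definition vertices T (H : T) : {set T} := [set v : T | vertex v & v <= H].

(* The dimension of the empty face is -1. *)
Definition fdim T (H : T) : int := (#|vertices H|%:Z - 1)%R.

Definition cdim T : int := ((\max_(H : T) #|vertices H|)%:Z - 1)%R.

(* Reduced cellular homology.  Each face H is oriented by the increasing order
   (given by enum_rank) of its vertices, so that the facet of H missing the
   vertex v has incidence number (-1) ^ #{vertices of H smaller than v}. *)
Definition smaller_vertices T (K H : T) : {set T} :=
  [set w in vertices H |
    [exists v in vertices H :\: vertices K,
      (enum_rank w < enum_rank v)%N]].

Definition incidence (k : fieldType) T (K H : T) : k :=
  if (K <= H) && (fdim H == fdim K + 1)%R
  then ((-1) ^+ #|smaller_vertices K H|)%R else 0%R.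

Definition boundary (k : fieldType) T (c : {ffun T -> k}) : {ffun T -> k} :=
  [ffun K : T => (\sum_(H : T) incidence k K H * c H)%R].

Definition is_chain (k : fieldType) T (i : int) (c : {ffun T -> k}) : Prop :=
  forall H : T, fdim H != i -> c H = 0%R.

Definition reduced_homology_vanishes (k : fieldType) T (i : int) : Prop :=
  forall c : {ffun T -> k}, is_chain i c -> boundary c = 0%R ->
  exists2 b : {ffun T -> k}, is_chain (i + 1)%R b & boundary b = c.

(* The link of F, with face poset {H | H >= F}. *)
Record link T (F : T) : Type := Link { link_face : T; _ : F <= link_face }.

Section Link.
Variables (T : finBPOrderType d) (F : T).

HB.instance Definition _ := [isSub for @link_face T F].
HB.instance Definition _ := [Finite of link F by <:].
HB.instance Definition _ := [SubChoice_isSubPOrder of link F by <: with d].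

Definition link_bot : link F := Link (lexx F).

Fact link_le0x (H : link F) : link_bot <= H.
Proof. by rewrite -Order.le_val; apply: (valP H). Qed.

HB.instance Definition _ := Order.hasBottom.Build d (link F) link_le0x.
End Link.

Definition cohen_macaulay_complex (k : fieldType) T : Prop :=
  forall (F : T) (i : int), (i < cdim (link F))%R ->
    reduced_homology_vanishes k (link F) i.

End BooleanCellComplex.

Section Quotient.
Local Open Scope group_scope.
Variable n : nat.

(* The faces of Delta(B_n). *)
Definition delta_faces : {set {set {set 'I_n}}} :=
  [set C : {set {set 'I_n}} |
    [forall A in C, (A != set0) && (A != setT)] &&
    [forall A in C, forall B in C, (A \subset B) || (B \subset A)]].

Variable G : {group 'S_n}.

Local Notation act := ('P^*^*)%act.

Record quotient_complex : Type := QuotientFace {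
  face_orbit : {set {set {set 'I_n}}};
  _ : face_orbit \in orbit act G @: delta_faces
}.

HB.instance Definition _ := [isSub for face_orbit].
HB.instance Definition _ := [Finite of quotient_complex by <:].

Definition quotient_le (O1 O2 : quotient_complex) : bool :=
  [exists C1 in val O1, exists C2 in val O2, C1 \subset C2].

Lemma act_subset (C D : {set {set 'I_n}}) (s : 'S_n) :
  (act C s \subset act D s) = (C \subset D).
Proof.
apply/idP/idP=> [sCD|]; last exact: imsetS.
by rewrite -(actK act s C) -(actK act s D); apply: imsetS.
Qed.

Lemma quotient_repr (O : quotient_complex) :
  exists2 C, C \in delta_faces & val O = orbit act G C.
Proof. by case/imsetP: (valP O) => C; exists C. Qed.

Lemma quotient_same (O : quotient_complex) C D :
  C \in val O -> D \in val O -> exists2 s, s \in G & D = act C s.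
Proof.
have [E _ ->] := quotient_repr O => /orbit_eqP <- /orbitP[s sG <-].
by exists s.
Qed.

Lemma quotient_act (O : quotient_complex) C s :
  s \in G -> C \in val O -> act C s \in val O.
Proof.
have [E _ ->] := quotient_repr O => sG /orbitP[t tG <-].
by rewrite -actM mem_orbit // groupM.
Qed.

Lemma quotient_eq (O1 O2 : quotient_complex) C :
  C \in val O1 -> C \in val O2 -> O1 = O2.
Proof.
have [E1 _ e1] := quotient_repr O1; have [E2 _ e2] := quotient_repr O2.
rewrite e1 e2 => /orbit_eqP h1 /orbit_eqP h2.
by apply: val_inj; rewrite e1 e2 -h1 -h2.
Qed.

Fact quotient_le_refl : reflexive quotient_le.
Proof.
move=> O; have [C _ e] := quotient_repr O.
have hC : C \in val O by rewrite e orbit_refl.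
by apply/exists_inP; exists C => //; apply/exists_inP; exists C.
Qed.

Fact quotient_le_anti : antisymmetric quotient_le.
Proof.
move=> O1 O2 /andP[].
case/exists_inP=> C1 h1 /exists_inP[C2 h2 s12].
case/exists_inP=> D2 k2 /exists_inP[D1 k1 s21].
have [s _ eD1] := quotient_same h1 k1; have [t _ eD2] := quotient_same h2 k2.
have : C1 == C2.
  rewrite eqEcard s12 -(card_setact ('P^*)%act C2 t) -eD2.
  by rewrite -(card_setact ('P^*)%act C1 s) -eD1 subset_leq_card.
by move/eqP=> eC; apply: (quotient_eq h1); rewrite eC.
Qed.

Fact quotient_le_trans : transitive quotient_le.
Proof.
move=> O2 O1 O3; case/exists_inP=> C1 h1 /exists_inP[C2 h2 s12].
case/exists_inP=> D2 k2 /exists_inP[D3 k3 s23].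
have [s sG e] := quotient_same h2 k2.
apply/exists_inP; exists (act C1 s); first exact: quotient_act.
by apply/exists_inP; exists D3 => //; rewrite (subset_trans _ s23) // e act_subset.
Qed.

HB.instance Definition _ :=
  Order.Le_isPOrder.Build (Order.Disp tt tt) quotient_complex
    quotient_le_refl quotient_le_anti quotient_le_trans.

Lemma quotient_leP (O1 O2 : quotient_complex) :
  reflect (exists C1 C2, [/\ C1 \in val O1, C2 \in val O2 & C1 \subset C2])
    (O1 <= O2)%O.
Proof.
apply: (iffP exists_inP) => [[C1 h1 /exists_inP[C2 h2 s]]|[C1 [C2 [h1 h2 s]]]].
  by exists C1, C2.
by exists C1 => //; apply/exists_inP; exists C2.
Qed.

Fact empty_face_subproof : orbit act G set0 \in orbit act G @: delta_faces.
Proof.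
apply: imset_f; rewrite inE; apply/andP.
by split; apply/forall_inP=> A; rewrite inE.
Qed.

Definition empty_face : quotient_complex := QuotientFace empty_face_subproof.

Fact quotient_le0x (O : quotient_complex) : (empty_face <= O)%O.
Proof.
have [C _ e] := quotient_repr O; apply/quotient_leP; exists set0, C.
by rewrite sub0set e !orbit_refl.
Qed.

HB.instance Definition _ :=
  Order.hasBottom.Build (Order.Disp tt tt) quotient_complex quotient_le0x.

Lemma delta_subset (C D : {set {set 'I_n}}) :
  D \subset C -> C \in delta_faces -> D \in delta_faces.
Proof.
move=> /subsetP sDC; rewrite !inE => /andP[/forall_inP h1 /forall_inP h2].
apply/andP; split; apply/forall_inP=> A /sDC AC; first exact: h1.
by apply/forall_inP=> B /sDC BC; apply: (forall_inP (h2 A AC)).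
Qed.

Lemma quotient_boolean : boolean_cell_complex quotient_complex.
Proof.
move=> O; have [C dC eO] := quotient_repr O.
pose D (A : {set 'I_#|C|}) := [set enum_val i | i in A].
have sDC A : D A \subset C.
  by apply/subsetP=> X /imsetP[i _ ->]; apply: enum_valP.
pose f A : quotient_complex :=
  QuotientFace (imset_f (orbit act G) (delta_subset (sDC A) dC)).
have fD A : D A \in val (f A) by exact: orbit_refl.
have CO : C \in val O by rewrite eO orbit_refl.
exists #|C|, f; split=> [A B|K]; last split.
- apply/idP/idP=> [/quotient_leP[E1 [E2 [h1 h2 sE]]]|sAB]; last first.
    by apply/quotient_leP; exists (D A), (D B); split; rewrite ?fD ?imsetS.
  have [t _ eE2] := quotient_same h2 (fD B).
  have [s _ eE1] := quotient_same (fD A) h1.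
  have {sE} : act (D A) (s * t) \subset D B by rewrite actM eE2 -eE1 act_subset.
  move=> /subsetP sE; apply/subsetP=> i iA.
  have hX : enum_val i \in D A by apply: imset_f.
  have hY := sE _ (imset_f (fun X => ('P^*)%act X (s * t)) hX).
  have /eqP cXY := card_setact 'P%act (enum_val i) (s * t).
  have XC := subsetP (sDC A) _ hX; have YC := subsetP (sDC B) _ hY.
  have eXY : enum_val i = ('P^*)%act (enum_val i) (s * t).
    have := dC; rewrite inE => /andP[_ /forall_inP h].
    have /orP[] := forall_inP (h _ XC) _ YC => sXY; apply/eqP.
      by rewrite eqEcard sXY (eqP cXY) /=.
    by rewrite eq_sym eqEcard sXY (eqP cXY) /=.
  move: hY; rewrite -eXY => /imsetP[j jB /enum_val_inj ->]; exact: jB.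
- case/quotient_leP=> C1 [C2 [h1 h2 s12]].
  have [s sG eC] := quotient_same h2 CO.
  exists (enum_val @^-1: act C1 s).
  apply: (@quotient_eq _ _ (act C1 s)); last exact: quotient_act.
  suff {1}-> : act C1 s = D (enum_val @^-1: act C1 s) by exact: fD.
  have sC : act C1 s \subset C by rewrite eC act_subset.
  apply/setP=> X; apply/idP/imsetP=> [hX|[i + ->]]; last by rewrite inE.
  by exists (enum_rank_in (subsetP sC _ hX) X); rewrite ?inE enum_rankK_in //;
    exact: (subsetP sC).
- by case=> A <-; apply/quotient_leP; exists (D A), C; rewrite fD CO sDC.
Qed.

End Quotient.

Section CohenMacaulayRing.
Local Open Scope ring_scope.
Variable R : comNzRingType.
Implicit Types (I J P M : R -> Prop) (s : seq R).

Definition ideal I : Prop :=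
  I 0 /\ forall a x y : R, I x -> I y -> I (a * x + y).

Definition prime_ideal P : Prop :=
  [/\ ideal P, ~ P 1 & forall x y : R, P (x * y) -> P x \/ P y].

Definition maximal_ideal M : Prop :=
  [/\ ideal M, ~ M 1 &
      forall J, ideal J -> ~ J 1 -> (forall x, M x -> J x) ->
        forall x, J x -> M x].

Definition gen_ideal s : R -> Prop :=
  fun x => exists c : 'I_(size s) -> R, x = \sum_(i < size s) c i * s`_i.

Definition noetherian_ring : Prop :=
  forall I, ideal I -> exists s, forall x, I x <-> gen_ideal s x.

Definition regular_sequence s : Prop :=
  ~ gen_ideal s 1 /\
  forall i : nat, (i < size s)%N ->
    forall x, gen_ideal (take i s) (s`_i * x) -> gen_ideal (take i s) x.

(* depth(I, R), the maximal length of a regular sequence in I *)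
Definition has_depth I (d : nat) : Prop :=
  (exists s, [/\ regular_sequence s, {in s, forall x, I x} & size s = d]) /\
  (forall s, regular_sequence s -> {in s, forall x, I x} -> (size s <= d)%N).

Definition prime_chain P (h : nat) : Prop :=
  exists Q : nat -> R -> Prop,
    [/\ forall i, (i <= h)%N -> prime_ideal (Q i),
        forall i, (i < h)%N -> (forall x, Q i x -> Q i.+1 x) /\
                               (exists2 x, Q i.+1 x & ~ Q i x) &
        forall x, Q h x <-> P x].

Definition has_height P (h : nat) : Prop :=
  prime_chain P h /\ forall h', prime_chain P h' -> (h' <= h)%N.

(* When R is noetherian and M is maximal, depth(M, R) and the height of M are
   the depth and the Krull dimension of the local ring R_M. *)
Definition cohen_macaulay_ring : Prop :=
  noetherian_ring /\
  forall M, maximal_ideal M -> exists d, has_depth M d /\ has_height M d.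

End CohenMacaulayRing.

Section Invariants.
Local Open Scope ring_scope.
Variables (k : fieldType) (n : nat) (G : {group 'S_n}).

Definition invariant : {pred {mpoly k[n]}} :=
  fun p => [forall s in G, msym s p == p].

Lemma invariantP (p : {mpoly k[n]}) :
  reflect (forall s, s \in G -> msym s p = p) (p \in invariant).
Proof. by apply: (iffP forall_inP) => h s /h /eqP. Qed.

Fact invariant_subring_closed : subring_closed invariant.
Proof.
split=> [|p q /invariantP hp /invariantP hq|p q /invariantP hp /invariantP hq];
  apply/invariantP=> s sG.
- exact: msym1.
- by rewrite msymB hp ?hq.
- by rewrite msymM hp ?hq.
Qed.

HB.instance Definition _ :=
  GRing.isSubringClosed.Build {mpoly k[n]} invariant invariant_subring_closed.

Record invariant_ring : Type := InvariantPoly {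
  invariant_poly : {mpoly k[n]};
  _ : invariant_poly \in invariant
}.

HB.instance Definition _ := [isSub for invariant_poly].
HB.instance Definition _ := [Choice of invariant_ring by <:].
HB.instance Definition _ :=
  [SubChoice_isSubComNzRing of invariant_ring by <:].

End Invariants.

Section WreathProduct.
Local Open Scope group_scope.
Variables l m : nat.

Definition wreath_row (i : 'I_m) : {set 'I_(l * m)} :=
  [set j : 'I_(l * m) | (j %/ l)%N == i].

Definition wreath_rows : {set {set 'I_(l * m)}} := [set wreath_row i | i : 'I_m].

(* S_l wr S_m, the stabiliser of the partition of {0, ..., lm-1} into rows *)
Definition wreath : {group 'S_(l * m)} := 'N(wreath_rows | 'P^*)%G.

End WreathProduct.

(* Main.v *)
Require Import Defs.
From mathcomp Require Import all_boot all_order all_algebra all_fingroup.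
From mathcomp.multinomials Require Import mpoly.
From mathcomp Require Import ring zify.

(** Both halves rest on the sign of the permutation that an element of the
    wreath product induces on the rows, a character with values in F_2.

    The complex.  The sets made of the first j columns of the rows 0 and 1,
    together with the initial segments of at least 2l points, form a chain
    whose gaps are the l pairs {(0,j), (1,j)} and singletons.  Its link before
    taking the quotient is a join of l copies of S^0, the sphere of dimension
    l - 1.  The stabiliser acts on this sphere through exchanging the rows 0
    and 1, that is by the antipodal map, so the link in the quotient is the
    real projective space of dimension l - 1 >= 2.  Its first homology over
    F_2 does not vanish: a cycle made of two edges with the same end points is
    paired to 1 by the cocycle of the double cover by the sphere
    ([double_cover], [down_count_act], [wreath_complex_not_cm]).

    The ring.  Write S for the polynomial ring, R for the invariants, and e(g)
    in F_2 for the sign above.  Suppose that y1, y2, y3 in R kill the class of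
    e in H^1(W, S), that is g a_i = a_i + e(g) y_i for some a_i in S.  Then
    u_ij = a_i y_j + a_j y_i is invariant and u_23 y1 + u_13 y2 + u_12 y3 = 0.
    If R were Cohen-Macaulay and y1, y2, y3 part of a system of parameters,
    the relation would be a Koszul relation, and
    a_1 y2 + a_2 y1 = u_12 would lie in the ideal of R generated by the other
    parameters.  This is a relation in S, where the parameters form a regular
    sequence, so a_1 lies in R modulo the parameters other than y2.  Applying
    an element with e(g) = 1 puts y1 in the ideal generated by y1 times a
    polynomial without constant term and by parameters of larger degree, which
    the lowest degree of y1 forbids ([cohomology_obstruction]).

    Only the weak form of regularity used here is proved: if a ring has a
    regular sequence at least as long as the family y, with entries in the
    radical of the ideal of y, then the first Koszul homology of y vanishes
    ([relation_of_regular]).  In characteristic two the Koszul complex has no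
    signs.  The long regular sequence in R comes from the hypothesis, since a
    chain of primes of length lm ends at the augmentation ideal
    ([prime_chain_augmentation]); in S it is the sequence of the variables.

    The three elements are Vandermonde products, in the rows, of three of the
    l elementary symmetric functions of a row; this is where l > 2 enters.  In
    characteristic two the product is the sum of all the terms of the
    determinant, and a_i is the sum over the even permutations.  In each of the
    three columns it replaces one coefficient of the polynomial whose roots are
    the row coefficients; [column_nilpotent] shows that the result is still a
    system of parameters. *)

Set Implicit Arguments.
Unset Strict Implicit.
Unset Printing Implicit Defensive.
Import Order.TTheory GRing.Theory.
Local Open Scope ring_scope.

(** * Counting *)

Lemma card_ord_ltn n t : (t <= n)%N -> #|[set j : 'I_n | (j < t)%N]| = t.
Proof.
move=> le; rewrite -sum1_card (eq_bigl (fun j : 'I_n => (j < t)%N)) => [|j].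
  by rewrite -(big_ord_widen _ (fun _ => 1%N) le) sum_nat_const card_ord muln1.
by rewrite inE.
Qed.

Lemma natr_pchar2 (A : nzRingType) (j : nat) :
  2%N \in [pchar A] -> j%:R = (odd j)%:R :> A.
Proof.
move=> char2; rewrite -[in LHS](odd_double_half j) natrD -mul2n natrM.
by have /andP[_ /eqP->] := char2; rewrite mul0r addr0.
Qed.

(** * Rows and columns of the wreath product *)

Section Rows.
Variables l m : nat.
Local Notation N := (l * m)%N.
Local Open Scope nat_scope.
Implicit Types (v w : 'I_N) (i : 'I_m) (j : 'I_l) (g : 'S_N).

Lemma width_gt0 v : 0 < l.
Proof.
have : 0 < N by apply: leq_ltn_trans (ltn_ord v).
by rewrite muln_gt0 => /andP[].
Qed.

Lemma row_of_subproof v : v %/ l < m.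
Proof. by rewrite ltn_divLR ?(width_gt0 v) // [X in _ < X]mulnC. Qed.
Definition row_of v : 'I_m := Ordinal (row_of_subproof v).

Lemma col_of_subproof v : v %% l < l.
Proof. by rewrite ltn_pmod ?(width_gt0 v). Qed.
Definition col_of v : 'I_l := Ordinal (col_of_subproof v).

Lemma cell_subproof i j : i * l + j < N.
Proof.
rewrite mulnC; apply: (@leq_trans (l * i.+1)); last by rewrite leq_mul2l ltn_ord orbT.
by rewrite mulnS addnC ltn_add2r.
Qed.
Definition cell i j : 'I_N := Ordinal (cell_subproof i j).

Lemma row_cell i j : row_of (cell i j) = i.
Proof.
apply: val_inj; rewrite /= divnMDl ?divn_small ?addn0 ?ltn_ord //.
exact: leq_ltn_trans (ltn_ord j).
Qed.

Lemma col_cell i j : col_of (cell i j) = j.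
Proof. by apply: val_inj; rewrite /= modnMDl modn_small. Qed.

Lemma cell_row_col v : cell (row_of v) (col_of v) = v.
Proof. by apply: val_inj; rewrite /= -divn_eq. Qed.

Lemma cell_inj i : injective (cell i).
Proof. by move=> j j' /(congr1 col_of); rewrite !col_cell. Qed.

Lemma mem_wreath_row v i : (v \in wreath_row l i) = (row_of v == i).
Proof. by rewrite inE. Qed.

Lemma card_row i : #|[set v | row_of v == i]| = l.
Proof.
suff -> : [set v | row_of v == i] = [set cell i j | j in [set: 'I_l]].
  by rewrite card_imset ?cardsT ?card_ord //; apply: cell_inj.
apply/setP=> v; rewrite inE; apply/eqP/imsetP => [<-|[j _ ->]].
  by exists (col_of v); rewrite ?cell_row_col.
exact: row_cell.
Qed.

(** An element stabilising the set of rows moves each row onto a row; since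
    rows are nonempty the induced map on row indices is injective. *)
Lemma wreath_row_perm g : 0 < l ->
  g \in wreath l m -> exists s : 'S_m, forall v, row_of (g v) = s (row_of v).
Proof.
move=> l_gt0 gW.
have /fin_all_exists[f hf] : forall i, exists i',
    ('P^*)%act (wreath_row l i : {set 'I_N}) g = wreath_row l i'.
  move=> i; have : ('P^*)%act (wreath_row l i) g \in wreath_rows l m.
    by rewrite (astabs_act _ gW) imset_f.
  by case/imsetP=> i' _ ->; exists i'.
have fE v : row_of (g v) = f (row_of v).
  apply/eqP; rewrite -mem_wreath_row -hf.
  by apply/imsetP; exists v; rewrite ?mem_wreath_row.
have f_inj : injective f.
  move=> i i' e; have := hf i; rewrite e -hf => /act_inj eqi.
  have : cell i (Ordinal l_gt0) \in wreath_row l i by rewrite mem_wreath_row row_cell.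
  by rewrite eqi mem_wreath_row row_cell => /eqP.
by exists (perm f_inj) => v; rewrite permE.
Qed.

Lemma mem_wreath g (s : 'S_m) :
  (forall v, row_of (g v) = s (row_of v)) -> g \in wreath l m.
Proof.
move=> gs; rewrite !inE; apply/subsetP => _ /imsetP[i _ ->]; rewrite inE.
apply/imsetP; exists (s i) => //; apply/setP=> v.
rewrite mem_wreath_row; apply/imsetP/eqP => [[w + ->]|e].
  by rewrite mem_wreath_row /= apermE gs => /eqP->.
exists ((g^-1)%g v); last by rewrite /= apermE permKV.
by rewrite mem_wreath_row -(inj_eq (@perm_inj _ s)) -gs permKV e.
Qed.

Definition permute_rows_fun (s : 'S_m) v : 'I_N := cell (s (row_of v)) (col_of v).

Lemma permute_rows_inj s : injective (permute_rows_fun s).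
Proof.
move=> v w e; rewrite -[v]cell_row_col -[w]cell_row_col; congr cell.
  by have := congr1 row_of e; rewrite !row_cell => /perm_inj.
by have := congr1 col_of e; rewrite !col_cell.
Qed.

Definition permute_rows (s : 'S_m) : 'S_N := perm (@permute_rows_inj s).

Lemma row_permute_rows s v : row_of (permute_rows s v) = s (row_of v).
Proof. by rewrite permE row_cell. Qed.

Lemma col_permute_rows s v : col_of (permute_rows s v) = col_of v.
Proof. by rewrite permE col_cell. Qed.

Lemma permute_rows_wreath s : permute_rows s \in wreath l m.
Proof. exact: mem_wreath (row_permute_rows s). Qed.

End Rows.

(** * Links in a quotient of the barycentric subdivision *)

Section QuotientLinks.
Local Open Scope order_scope.
Variables (n : nat) (G : {group 'S_n}).
Local Notation act := ('P^*^*)%act.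
Implicit Types (C D E : {set {set 'I_n}}) (A : {set 'I_n}) (s : 'S_n).

(** Elements of a chain are determined by their cardinality, which every
    permutation preserves.  All rigidity of faces under the group comes from
    this. *)
Lemma delta_card_inj C A A' :
  C \in delta_faces n -> A \in C -> A' \in C -> #|A| = #|A'| -> A = A'.
Proof.
rewrite inE => /andP[_ /forall_inP h] AC A'C e.
have /orP[] := forall_inP (h _ AC) _ A'C => sAA'; apply/eqP.
  by rewrite eqEcard sAA' e /=.
by rewrite eq_sym eqEcard sAA' e /=.
Qed.

Lemma act_subchain C D s : C \in delta_faces n -> D \subset C ->
  act D s \subset C -> act D s = D.
Proof.
move=> dC /subsetP DC /subsetP sDC.
have fix_ A : A \in D -> ('P^*)%act A s = A.
  move=> AD; apply: (delta_card_inj dC); [|exact: DC|exact: card_setact].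
  by apply: sDC; apply: (imset_f (fun X => ('P^*)%act X s)).
by rewrite /= /setact (eq_in_imset fix_) imset_id.
Qed.

Lemma delta_act C s : C \in delta_faces n -> act C s \in delta_faces n.
Proof.
rewrite !inE => /andP[/forall_inP h1 /forall_inP h2]; apply/andP; split.
  apply/forall_inP=> _ /imsetP[A /h1/andP[A0 AT] ->].
  have cA := card_setact 'P%act A s.
  apply/andP; split; [apply: contraNneq A0 | apply: contraNneq AT] => e.
    by rewrite -cards_eq0 -cA cards_eq0; apply/eqP.
  rewrite eqEcard subsetT -cA; move/eqP: e.
  by rewrite eqEcard => /andP[].
apply/forall_inP=> _ /imsetP[A /h2/forall_inP{}h2 ->].
apply/forall_inP=> _ /imsetP[B /h2 AB ->].
by case/orP: AB => AB; rewrite (imsetS _ AB) ?orbT.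
Qed.

(** The total map from families to faces avoids carrying a proof that the family
    is a chain; families that are not chains get the empty face. *)
Definition face C : quotient_complex G := insubd (empty_face G) (orbit act G C).

Lemma val_face C : C \in delta_faces n -> val (face C) = orbit act G C.
Proof. by move=> dC; rewrite val_insubd imset_f. Qed.

Lemma face_act C s : s \in G -> face (act C s) = face C.
Proof. by move=> sG; rewrite /face orbit_act. Qed.

Lemma face_surj (H : quotient_complex G) : exists2 C, C \in delta_faces n & H = face C.
Proof.
have [C dC e] := quotient_repr H; exists C => //.
by apply: val_inj; rewrite val_face.
Qed.

(** Below a fixed face, inclusion of orbits is inclusion of subchains: a
    translate of a subchain that lies in the same chain is the subchain
    itself. *)
Lemma face_le C D E : C \in delta_faces n -> D \subset C -> E \subset C ->
  (face D <= face E) = (D \subset E).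
Proof.
move=> dC DC EC; have dD := delta_subset DC dC; have dE := delta_subset EC dC.
apply/quotient_leP/idP => [[D' [E' []]]|DE]; last first.
  by exists D, E; rewrite !val_face // !orbit_refl.
rewrite !val_face // => /orbitP[s _ <-] /orbitP[t _ <-] sub.
have {}sub : act D (s * t^-1)%g \subset E.
  by rewrite actM -(actK act t E) act_subset.
by rewrite -(act_subchain dC DC (subset_trans sub EC)).
Qed.

Lemma face_below C K : C \in delta_faces n -> K <= face C ->
  exists2 D : {set {set 'I_n}}, D \subset C & K = face D.
Proof.
move=> dC /quotient_leP[D [E [KD]]]; rewrite val_face // => /orbitP[s sG <-] sub.
have sub' : act D s^-1%g \subset C by rewrite -(actK act s C) act_subset.
exists (act D s^-1%g) => //; have dD := delta_subset sub' dC.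
apply: (quotient_eq (C := act D s^-1%g)); first by apply: quotient_act; rewrite ?groupV.
by rewrite val_face ?orbit_refl.
Qed.

Variables (C0 : {set {set 'I_n}}) (dC0 : C0 \in delta_faces n).
Local Notation F := (face C0).

Definition link_of C : link F := insubd (link_bot F) (face C).

Lemma val_link_of C : C \in delta_faces n -> C0 \subset C -> val (link_of C) = face C.
Proof. by move=> dC C0C; rewrite val_insubd (face_le dC C0C (subxx C)) C0C. Qed.

Lemma link_of_bot : link_of C0 = \bot.
Proof. by apply: val_inj; rewrite val_link_of. Qed.

Lemma link_of_le C D E : C \in delta_faces n ->
  C0 \subset D -> C0 \subset E -> D \subset C -> E \subset C ->
  (link_of D <= link_of E) = (D \subset E).
Proof.
move=> dC C0D C0E DC EC.
by rewrite -Order.le_val !val_link_of ?(face_le dC) ?(delta_subset _ dC).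
Qed.

(** A face above the orbit of [C0] has a representative containing [C0]: translate
    any representative by the inverse of the group element that carries [C0] into
    it. *)
Lemma link_of_surj (H : link F) :
  exists C, [/\ C \in delta_faces n, C0 \subset C & H = link_of C].
Proof.
have [D dD eD] := face_surj (val H); have := valP H; rewrite /= eD => le.
have /quotient_leP[C1 [C [h1 h sub]]] := le.
move: h1; rewrite val_face // => /orbitP[s sG e1].
have C0C : C0 \subset act C s^-1%g.
  by rewrite -(actK act s C0) act_subset e1.
move: h; rewrite val_face // => /orbitP[t tG et].
have dC : act C s^-1%g \in delta_faces n.
  rewrite -et; do 2!apply: delta_act; exact: dD.
exists (act C s^-1%g); split=> //; apply: val_inj.
by rewrite val_link_of // eD -et -actM face_act // groupM ?groupV.
Qed.

Lemma link_of_below C (K : link F) : C \in delta_faces n -> C0 \subset C ->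
  K <= link_of C -> exists D : {set {set 'I_n}}, [/\ C0 \subset D, D \subset C & K = link_of D].
Proof.
move=> dC C0C; rewrite -Order.le_val val_link_of // => /(face_below dC)[D DC eD].
exists D; have C0D : C0 \subset D.
  by rewrite -(face_le dC C0C DC) -eD (valP K).
by split=> //; apply: val_inj; rewrite val_link_of // (delta_subset DC dC).
Qed.

Lemma link_of_inj C D E : C \in delta_faces n ->
  C0 \subset D -> C0 \subset E -> D \subset C -> E \subset C ->
  link_of D = link_of E -> D = E.
Proof.
move=> dC C0D C0E DC EC e; apply/eqP; rewrite eqEsubset.
by rewrite -(link_of_le dC C0D C0E DC EC) -(link_of_le dC C0E C0D EC DC) e lexx.
Qed.

(** By [link_of_le] the interval below [link_of C] is the Boolean algebra on the
    elements that [C] adds to [C0], and its atoms come from adding one of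
    them. *)
Lemma vertices_link_of C : C \in delta_faces n -> C0 \subset C ->
  vertices (link_of C) = [set link_of (A |: C0) | A in C :\: C0].
Proof.
move=> dC C0C; have sub A D : C0 \subset D -> A \in D -> A |: C0 \subset D.
  by move=> C0D AD; rewrite subUset sub1set AD.
have supA A : C0 \subset A |: C0 by apply: subsetUr.
apply/setP=> v; rewrite inE; apply/andP/imsetP => [[]|[A /setDP[AC AnC0] ->]].
  case/andP=> nv /forallP minv /(link_of_below dC C0C)[D [C0D DC eD]].
  have /subsetPn[A AD AnC0] : ~~ (D \subset C0).
    apply: contra nv => DC0; rewrite eD -link_of_bot; apply/eqP.
    by congr link_of; apply/eqP; rewrite eqEsubset DC0.
  have AC := subsetP DC _ AD.
  exists A; first by rewrite inE AnC0.
  apply/eqP; rewrite eq_sym; apply/negPn/negP => ne.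
  have := minv (link_of (A |: C0)); rewrite lt_neqAle ne eD /=.
  rewrite (link_of_le dC) ?sub //= -link_of_bot => /eqP/(link_of_inj dC).
  move=> /(_ (supA A) (subxx _) (sub _ _ C0C AC) C0C) /setP/(_ A).
  by rewrite setU11 (negPf AnC0).
split; last by rewrite (link_of_le dC) // sub.
apply/andP; split.
  rewrite -link_of_bot; apply/eqP => /(link_of_inj dC).
  move=> /(_ (supA A) (subxx _) (sub _ _ C0C AC) C0C) /setP/(_ A).
  by rewrite setU11 (negPf AnC0).
apply/forallP=> w; apply/implyP; rewrite lt_neqAle => /andP[nw le].
have AC0C := sub _ _ C0C AC; have dA := delta_subset AC0C dC.
have [D [C0D DA eD]] := link_of_below dA (supA A) le.
rewrite eD -link_of_bot; apply/eqP; congr link_of; apply/eqP.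
rewrite eqEsubset C0D andbT; apply/subsetP => X XD.
have := subsetP DA _ XD; rewrite in_setU1 => /orP[/eqP eX|//].
case/eqP: nw; rewrite eD; congr link_of; apply/eqP; rewrite eqEsubset DA.
by rewrite sub // -eX.
Qed.

Lemma card_vertices_link_of C : C \in delta_faces n -> C0 \subset C ->
  #|vertices (link_of C)| = #|C :\: C0|.
Proof.
move=> dC C0C; rewrite vertices_link_of // card_in_imset // => A B.
move=> /setDP[AC An] /setDP[BC Bn] /(link_of_inj dC).
rewrite !subsetUr !subUset !sub1set AC BC C0C => /(_ isT isT isT isT) /setP/(_ A).
by rewrite setU11 in_setU1 (negPf An) orbF => /esym/eqP.
Qed.

Lemma fdim_link_of C : C \in delta_faces n -> C0 \subset C ->
  fdim (link_of C) = (#|C :\: C0|%:Z - 1)%R.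
Proof. by move=> dC C0C; rewrite /fdim card_vertices_link_of. Qed.

End QuotientLinks.

(** * A projective space among the links *)

Section Pairing.
Variables (k : fieldType) (char2 : 2%N \in [pchar k]%R).
Variables (d : Order.disp_t) (T : finBPOrderType d).
Local Open Scope ring_scope.

Lemma incidence_pchar2 (K H : T) :
  incidence k K H = ((K <= H)%O && (fdim H == fdim K + 1))%:R.
Proof. by rewrite /incidence (oppr_pchar2 char2) expr1n; case: ifP. Qed.

Lemma sum_indicator (f : T -> k) (L : T) : \sum_H f H * (H == L)%:R = f L.
Proof.
rewrite (bigD1 L) //= eqxx mulr1 big1 ?addr0 // => H /negPf->.
exact: mulr0.
Qed.

(** The boundary and coboundary maps are adjoint: a cocycle pairs to zero with
    every boundary. *)
Lemma cocycle_obstruction (i : int) (c : {ffun T -> k}) (phi : T -> k) :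
  is_chain i c -> boundary c = 0 -> \sum_K phi K * c K != 0 ->
  (forall H, fdim H = i + 1 -> \sum_(K | (K <= H)%O && (fdim K == i)) phi K = 0) ->
  ~ reduced_homology_vanishes k T i.
Proof.
move=> ic dc nz cocyc vanish; have [b ib eb] := vanish c ic dc.
case/eqP: nz; transitivity (\sum_H (\sum_K phi K * incidence k K H) * b H).
  rewrite -eb; under eq_bigr do rewrite ffunE mulr_sumr.
  rewrite exchange_big; apply: eq_bigr => H _; rewrite mulr_suml.
  by apply: eq_bigr => K _; rewrite mulrA.
apply: big1 => H _; have [eH|nH] := eqVneq (fdim H) (i + 1); last first.
  by rewrite ib ?mulr0.
rewrite [X in X * _](_ : _ = 0) ?mul0r //; rewrite -[RHS](cocyc H eH).
rewrite [RHS]big_mkcond; apply: eq_bigr => K _.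
rewrite incidence_pchar2 eH (inj_eq (addIr _)) eq_sym.
by case: (_ && _); rewrite ?mulr1 ?mulr0.
Qed.

(** In characteristic two, two cells with the same facets form a cycle. *)
Lemma two_cell_cycle_obstruction (i : int) (L L' : T) (phi : T -> k) :
  fdim L = i -> fdim L' = i ->
  (forall K : T, fdim K + 1 = i -> (K <= L)%O = (K <= L')%O) ->
  phi L + phi L' != 0 ->
  (forall H, fdim H = i + 1 -> \sum_(K | (K <= H)%O && (fdim K == i)) phi K = 0) ->
  ~ reduced_homology_vanishes k T i.
Proof.
move=> fL fL' same nz cocyc.
pose c : {ffun T -> k} := [ffun H => (H == L)%:R + (H == L')%:R].
have pair f : \sum_H f H * c H = f L + f L'.
  under eq_bigr do rewrite ffunE mulrDr.
  by rewrite big_split /= !sum_indicator.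
apply: (cocycle_obstruction (c := c) (phi := phi)) => //; last by rewrite pair.
  move=> H nH; rewrite ffunE.
  have [e|_] := eqVneq H L; first by rewrite e fL eqxx in nH.
  have [e|_] := eqVneq H L'; first by rewrite e fL' eqxx in nH.
  by rewrite addr0.
apply/ffunP=> K; rewrite !ffunE pair !incidence_pchar2 fL fL'.
have [fK|_] := eqVneq i (fdim K + 1); last by rewrite !andbF addr0.
by rewrite !andbT same // addrr_pchar2.
Qed.
End Pairing.

Section WreathComplex.
Local Open Scope order_scope.
Variables (l m : nat) (l3 : (2 < l)%N) (m2 : (1 < m)%N).
Local Notation N := (l * m)%N.
Local Notation W := (wreath l m).
Local Notation act := ('P^*^*)%act.
Implicit Types (A X : {set 'I_N}) (C D : {set {set 'I_N}}) (v : 'I_N).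

Let r0 : 'I_m := Ordinal (ltnW m2).
Let r1 : 'I_m := Ordinal m2.

Definition two_rows (a b : nat) : {set 'I_N} :=
  [set v | (row_of v == r0) && (col_of v < a)%N
        || (row_of v == r1) && (col_of v < b)%N].

Definition initial (p : nat) : {set 'I_N} := [set v : 'I_N | (v < p)%N].

Definition row_count (i : 'I_m) A : nat := #|[set v in A | row_of v == i]|.

Lemma r01 : r0 != r1. Proof. by []. Qed.

Lemma row_count_cols i A t : (t <= l)%N ->
  (forall v, row_of v = i -> (v \in A) = (col_of v < t)%N) -> row_count i A = t.
Proof.
move=> tl h; rewrite -[RHS](card_ord_ltn tl) -(card_imset _ (@cell_inj l m i)).
apply: eq_card => v; rewrite inE; apply/andP/imsetP => [[vA /eqP rv]|[j]].
  by exists (col_of v); rewrite ?inE -?h // -rv cell_row_col.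
by rewrite inE => jt ->; rewrite h row_cell // col_cell.
Qed.

Lemma row_count_two_rows a b : (a <= l)%N -> (b <= l)%N ->
  row_count r0 (two_rows a b) = a /\ row_count r1 (two_rows a b) = b.
Proof.
move=> al bl; split; apply: row_count_cols => // v rv; rewrite inE rv.
  by rewrite eqxx (negPf r01) orbF.
by rewrite eqxx eq_sym (negPf r01).
Qed.

Lemma row_count_initial p : (2 * l <= p)%N ->
  row_count r0 (initial p) = l /\ row_count r1 (initial p) = l.
Proof.
move=> lp; split; apply: row_count_cols => // v rv; rewrite inE ltn_ord;
  rewrite -[v]cell_row_col rv /=; have := ltn_ord (col_of v); rewrite /=; lia.
Qed.

Lemma card_row_counts A : A \subset two_rows l l ->
  #|A| = (row_count r0 A + row_count r1 A)%N.
Proof.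
move/subsetP=> sub; rewrite -(cardsID [set v | row_of v == r0] A).
congr (_ + _)%N; apply: eq_card => v; rewrite !inE //.
case vA: (v \in A); rewrite ?andbF //= andbT.
have := sub v vA; rewrite inE => /orP[/andP[/eqP-> _]|/andP[/eqP-> _]].
  by rewrite eqxx.
by rewrite eqxx eq_sym (negPf r01).
Qed.

Lemma two_rows_mono a b a' b' : (a <= a')%N -> (b <= b')%N ->
  two_rows a b \subset two_rows a' b'.
Proof.
move=> aa bb; apply/subsetP=> v; rewrite !inE.
by case/orP=> /andP[-> h]; rewrite ?(leq_trans h aa) ?(leq_trans h bb) //= orbT.
Qed.

Lemma two_rows_sub a b : two_rows a b \subset two_rows l l.
Proof.
apply/subsetP=> v; rewrite !inE.
by case/orP=> /andP[-> _]; rewrite ltn_ord //= ?orbT.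
Qed.

Lemma two_rows_initial a b p : (2 * l <= p)%N -> two_rows a b \subset initial p.
Proof.
move=> lp; apply/subsetP=> v; rewrite !inE -[X in (X < p)%N](congr1 val (cell_row_col v)) /=.
have := ltn_ord (col_of v); rewrite /=.
by move=> h /orP[/andP[/eqP/(congr1 val)/= -> _]|/andP[/eqP/(congr1 val)/= -> _]]; lia.
Qed.

Lemma initial_mono p q : (p <= q)%N -> initial p \subset initial q.
Proof. by move=> pq; apply/subsetP=> v; rewrite !inE => /leq_trans; apply. Qed.

Lemma card_two_rows a b : (a <= l)%N -> (b <= l)%N -> #|two_rows a b| = (a + b)%N.
Proof.
by move=> al bl; rewrite card_row_counts ?two_rows_sub //; have [-> ->] := row_count_two_rows al bl.
Qed.

(** The sets [two_rows a b] with [P a b] and the initial segments containing the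
    first two rows, without the empty and the full set.  The initial segments
    leave no room for vertices of the link outside the first two rows.  When
    [m = 2] the set [two_rows l l] is the full set and must be left out. *)
Definition ladder (P : rel nat) : {set {set 'I_N}} :=
  [set A | [&& A != set0, A != setT &
    [exists a : 'I_l.+1, exists b : 'I_l.+1, P a b && (A == two_rows a b)]
    || [exists p : 'I_N, (2 * l <= p)%N && (A == initial p)]]].

Lemma ladderP P A : A \in ladder P ->
  [/\ A != set0, A != setT &
   (exists a b, [/\ (a <= l)%N, (b <= l)%N, P a b & A = two_rows a b]) \/
   (exists p, (2 * l <= p < N)%N /\ A = initial p)].
Proof.
rewrite inE => /and3P[A0 AT h]; split=> //; case/orP: h.
  case/existsP=> a /existsP[b /andP[Pab /eqP eA]]; left.
  by exists a, b; rewrite -ltnS ltn_ord -ltnS ltn_ord.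
by case/existsP=> p /andP[lp /eqP eA]; right; exists p; rewrite lp ltn_ord.
Qed.

Lemma ladder_two_rows (P : rel nat) a b : (a <= l)%N -> (b <= l)%N ->
  two_rows a b != set0 -> two_rows a b != setT -> P a b -> two_rows a b \in ladder P.
Proof.
move=> al bl A0 AT Pab; rewrite inE A0 AT; apply/orP; left.
apply/existsP; exists (Ordinal (al : (a < l.+1)%N)).
by apply/existsP; exists (Ordinal (bl : (b < l.+1)%N)); rewrite Pab /=.
Qed.

Lemma mem_ladder_two_rows (P : rel nat) a b : (a <= l)%N -> (b <= l)%N ->
  (0 < a + b < N)%N -> P a b -> two_rows a b \in ladder P.
Proof.
move=> al bl /andP[lb ub]; apply: ladder_two_rows => //.
  by rewrite -card_gt0 card_two_rows.
apply: contraTneq ub => e.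
by rewrite -(card_two_rows al bl) e cardsT card_ord ltnn.
Qed.

Lemma mem_ladder_initial (P : rel nat) p : (2 * l <= p < N)%N -> initial p \in ladder P.
Proof.
move=> /andP[lp pN]; have cp : #|initial p| = p by apply: card_ord_ltn; apply: ltnW.
rewrite inE; apply/and3P; split.
- by rewrite -card_gt0 cp; lia.
- by apply: contraTneq pN => e; rewrite -cp e cardsT card_ord ltnn.
by apply/orP; right; apply/existsP; exists (Ordinal pN); rewrite /= lp eqxx.
Qed.

Lemma ladder_sub (P Q : rel nat) : (forall a b, P a b -> Q a b) -> ladder P \subset ladder Q.
Proof.
move=> PQ; apply/subsetP=> A; rewrite !inE => /and3P[-> -> /=] /orP[|->]; last by rewrite orbT.
case/existsP=> a /existsP[b /andP[/PQ h e]]; apply/orP; left.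
by apply/existsP; exists a; apply/existsP; exists b; rewrite h.
Qed.

Lemma ladder_delta (P : rel nat) :
  (forall a b a' b', P a b -> P a' b' ->
     (a <= a')%N && (b <= b')%N || (a' <= a)%N && (b' <= b)%N) ->
  ladder P \in delta_faces N.
Proof.
move=> cmp; rewrite inE; apply/andP; split; apply/forall_inP => A /ladderP[A0 AT hA].
  by rewrite A0 AT.
apply/forall_inP => B /ladderP[_ _ hB].
case: hA hB => [[a [b [_ _ Pab ->]]]|[p [/andP[lp _] ->]]]
  [[a' [b' [_ _ Pab' ->]]]|[q [/andP[lq _] ->]]].
- apply/orP; case/orP: (cmp _ _ _ _ Pab Pab') => /andP[h1 h2]; [left|right];
    exact: two_rows_mono.
- by rewrite two_rows_initial.
- by rewrite (two_rows_initial _ _ lp) orbT.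
- by apply/orP; case/orP: (leq_total p q) => h; [left|right]; apply: initial_mono.
Qed.

(** The chain whose link is a projective space: consecutive sets differ by one
    column of the first two rows, or by one point. *)
Definition base : {set {set 'I_N}} := ladder (fun a b => a == b).

Lemma base_delta : base \in delta_faces N.
Proof.
apply: ladder_delta => a b a' b' /eqP-> /eqP->; rewrite !andbb.
exact: leq_total.
Qed.

Lemma base_balanced A : A \in base -> row_count r0 A = row_count r1 A.
Proof.
case/ladderP=> _ _ [[a [b [al bl /eqP eab ->]]]|[p [/andP[lp _] ->]]].
  by have [-> ->] := row_count_two_rows al bl.
by have [-> ->] := row_count_initial lp.
Qed.

Lemma two_rows_notin_base a b : (a <= l)%N -> (b <= l)%N -> a != b ->
  two_rows a b \notin base.
Proof.
move=> al bl ab; apply: contra ab => /base_balanced.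
by have [-> ->] := row_count_two_rows al bl => ->.
Qed.

(** The sizes missing from the chain are the odd numbers below [2 * l]: one
    vertex of the link for each column of the first two rows. *)
Lemma base_size p : (0 < p < N)%N -> (odd p -> 2 * l <= p)%N ->
  exists2 A : {set 'I_N}, A \in base & #|A| = p.
Proof.
move=> /andP[p0 pN] hp; have [le|lt] := leqP (2 * l) p.
  exists (initial p); first by apply: mem_ladder_initial; rewrite le.
  by apply: card_ord_ltn; apply: ltnW.
have ev : ~~ odd p by apply: contraL lt => /hp; rewrite -leqNgt.
have ep : (p./2 + p./2 = p)%N by rewrite addnn even_halfK.
have hl : (p./2 <= l)%N by lia.
exists (two_rows p./2 p./2); last by rewrite card_two_rows.
by apply: mem_ladder_two_rows; rewrite ?ep ?p0 ?eqxx.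
Qed.

Section OverBase.
Variables (C : {set {set 'I_N}}) (dC : C \in delta_faces N) (C0C : base \subset C).

Lemma card_proper A : A \in C -> (0 < #|A| < N)%N.
Proof.
have := dC; rewrite inE => /andP[/forall_inP h _] /h/andP[A0 AT].
rewrite card_gt0 A0 /= ltnNge; apply: contra AT => le.
by rewrite eqEcard subsetT cardsT card_ord.
Qed.

Lemma extra_size A : A \in C :\: base -> odd #|A| /\ (#|A| < 2 * l)%N.
Proof.
move=> /setDP[AC AnC0]; have pA := card_proper AC.
have h : ~ (odd #|A| -> 2 * l <= #|A|)%N.
  move=> hp; have [B BC0 eB] := base_size pA hp; case/negP: AnC0.
  by rewrite -(delta_card_inj dC (subsetP C0C _ BC0) AC eB).
case o: (odd #|A|) h => h; last by case: h.
by split=> //; rewrite ltnNge; apply/negP => le; apply: h.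
Qed.

(** A set added to [base] has odd size and lies between two consecutive sets of
    [base], so it meets the first two rows in different numbers of points.  The
    row with more points is the sign of the vertex on the sphere. *)
Lemma extra_unbalanced A : A \in C :\: base -> row_count r0 A != row_count r1 A.
Proof.
move=> AE; have [oA ltA] := extra_size AE; have /setDP[AC _] := AE.
have AB : A \subset two_rows l l.
  have [ltN|geN] := ltnP (l + l) N; last first.
    apply: (subset_trans (subsetT A)).
    suff -> : two_rows l l = setT by [].
    by apply/eqP; rewrite eqEcard subsetT cardsT card_ord card_two_rows.
  have BC : two_rows l l \in C.
    apply: (subsetP C0C); apply: mem_ladder_two_rows => //.
    by rewrite ltN andbT; lia.
  have := dC; rewrite inE => /andP[_ /forall_inP h].
  case/orP: (forall_inP (h _ AC) _ BC) => // /subset_leq_card.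
  by rewrite card_two_rows //; lia.
by apply: contraL oA => /eqP e; rewrite card_row_counts // e addnn odd_double.
Qed.
End OverBase.

(** The sphere has two vertices in each column, and [leans_down] tells them
    apart. *)
Definition leans_down A : bool := (row_count r0 A < row_count r1 A)%N.

Definition down_count C : nat := #|[set A in C :\: base | leans_down A]|.

Lemma row_count_act (g : 'S_N) (s : 'S_m) i A : (forall v, row_of (g v) = s (row_of v)) ->
  row_count (s i) (('P^*)%act A g) = row_count i A.
Proof.
move=> gs; rewrite /row_count -[RHS](card_imset _ (@perm_inj _ g)).
apply: eq_card => v; rewrite inE; apply/andP/imsetP => [[/imsetP[w wA ->]]|[w]].
  by rewrite gs (inj_eq perm_inj) => rw; exists w; rewrite ?inE ?wA.
rewrite inE => /andP[wA /eqP rw ->]; rewrite gs rw eqxx; split=> //.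
by apply/imsetP; exists w.
Qed.

(** An element carrying one refinement of [base] to another fixes the union of the
    first two rows, so it preserves or exchanges them.  An exchange reverses the
    sign of every vertex, and turns the number of negative vertices of an edge
    into 2 minus that number. *)
Lemma down_count_act C D (g : 'S_N) : C \in delta_faces N -> base \subset C ->
  D \in delta_faces N -> base \subset D -> g \in W -> D = act C g ->
  #|C :\: base| = 2%N -> odd (down_count D) = odd (down_count C).
Proof.
move=> dC C0C dD C0D gW eD c2.
have gbase : act base g = base.
  by apply: (act_subchain dD C0D); rewrite eD act_subset.
have eE : D :\: base = [set ('P^*)%act A g | A in C :\: base].
  apply/setP=> X; rewrite -[in LHS]gbase eD -[X](actKV ('P^*)%act g).
  have mem A E : (('P^*)%act A g \in act E g) = (A \in E).
    exact: (mem_imset _ _ (@act_inj _ _ _ ('P^*)%act g)).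
  by rewrite in_setD !mem in_setD.
have [s gs] := wreath_row_perm (leq_ltn_trans (leq0n _) l3) gW.
have countE : down_count D = #|[set A in C :\: base | leans_down (('P^*)%act A g)]|.
  rewrite /down_count eE -[RHS](card_imset _ (@act_inj _ _ _ ('P^*)%act g)).
  apply: eq_card => X; rewrite in_set; apply/andP/imsetP => [[/imsetP[A AE ->] h]|[A]].
    by exists A; rewrite // in_set AE.
  by rewrite in_set => /andP[AE h] ->; split=> //; apply: imset_f.
have stab : ('P^*)%act (two_rows l l) g = two_rows l l.
  have cB : #|two_rows l l| = #|('P^*)%act (two_rows l l) g| by rewrite card_setact.
  have [ltN|geN] := ltnP (l + l) N.
    have B0 : two_rows l l \in base.
      by apply: mem_ladder_two_rows; rewrite // ltN andbT; lia.
    apply: (delta_card_inj base_delta) => //.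
    by rewrite -gbase; apply: (imset_f (fun X => ('P^*)%act X g)).
  have full X : #|X| = #|two_rows l l| -> X = setT.
    by move=> e; apply/eqP; rewrite eqEcard subsetT cardsT card_ord e card_two_rows.
  exact: etrans (full _ (esym cB)) (esym (full _ (erefl _))).
have l_gt0 : (0 < l)%N by apply: leq_ltn_trans l3.
have sr i : (i == r0) || (i == r1) -> (s i == r0) || (s i == r1).
  move=> hi; pose v := cell i (Ordinal l_gt0).
  have vB : v \in two_rows l l by rewrite inE row_cell !ltn_ord !andbT.
  have : g v \in two_rows l l by rewrite -stab; apply: (imset_f (fun x => ('P)%act x g)).
  by rewrite inE gs row_cell !ltn_ord !andbT.
have cnt := row_count_act _ _ gs.
have ne : s r1 != s r0 by rewrite (inj_eq perm_inj).
have /orP[/eqP s0|/eqP s0] := sr r0 isT; have /orP[/eqP s1|/eqP s1] := sr r1 isT;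
  try by rewrite s0 s1 eqxx in ne.
  rewrite countE; congr (odd _); apply: eq_card => A; rewrite !inE; congr (_ && _).
  by rewrite /leans_down -{1}s0 -{1}s1 !cnt.
have flip A : A \in C :\: base -> leans_down (('P^*)%act A g) = ~~ leans_down A.
  move/(extra_unbalanced dC C0C).
  have := cnt r1 A; have := cnt r0 A; rewrite s0 s1 /leans_down => -> ->.
  by case: ltngtP.
have : (down_count D + down_count C = 2)%N.
  rewrite -c2 countE addnC /down_count; move: (C :\: base) flip => E flip.
  rewrite -[RHS](cardsID [set A | leans_down A]).
  congr (_ + _)%N; apply: eq_card => A; rewrite !inE //.
  by case AE: (A \in E); rewrite ?(flip _ AE) ?andbT ?andbF.
by move=> e; have := oddD (down_count D) (down_count C); rewrite e /=; case: odd; case: odd.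
Qed.

(** The antipodal map of the sphere. *)
Definition row_flip : 'S_N := permute_rows l (tperm r0 r1).

Lemma act_row_flip_sub X A : (forall v, v \in X -> row_flip v \in A) -> (#|A| <= #|X|)%N ->
  ('P^*)%act X row_flip = A.
Proof.
move=> h le; apply/eqP; rewrite eqEcard card_setact le andbT.
by apply/subsetP => _ /imsetP[v vX ->]; apply: h.
Qed.

Lemma act_two_rows a b : (a <= l)%N -> (b <= l)%N ->
  ('P^*)%act (two_rows a b) row_flip = two_rows b a.
Proof.
move=> al bl; apply: act_row_flip_sub; last by rewrite !card_two_rows // addnC.
move=> v; rewrite !inE row_permute_rows col_permute_rows.
case/orP=> /andP[/eqP-> ->]; rewrite ?tpermL ?tpermR !eqxx ?orbT //.
Qed.

Lemma act_initial p : (2 * l <= p)%N -> ('P^*)%act (initial p) row_flip = initial p.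
Proof.
move=> lp; apply: act_row_flip_sub => // v; rewrite !inE => vp.
case: (tpermP r0 r1 (row_of v)) (row_permute_rows (tperm r0 r1) v) => [_ e|_ e|_ _ e].
- have /(subsetP (two_rows_initial l l lp)) : row_flip v \in two_rows l l.
    by rewrite inE e ltn_ord eqxx orbT.
  by rewrite inE.
- have /(subsetP (two_rows_initial l l lp)) : row_flip v \in two_rows l l.
    by rewrite inE e ltn_ord eqxx.
  by rewrite inE.
suff -> : row_flip v = v by [].
by rewrite -[LHS]cell_row_col e col_permute_rows cell_row_col.
Qed.

Lemma act_base : act base row_flip = base.
Proof.
have fix_ A : A \in base -> ('P^*)%act A row_flip = A.
  case/ladderP=> _ _ [[a [b [al bl /eqP <- ->]]]|[p [/andP[lp _] ->]]].
    exact: act_two_rows.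
  exact: act_initial.
by rewrite /= /setact (eq_in_imset fix_) imset_id.
Qed.

(** Refinements of [base] by the sets [two_rows a b] for listed pairs: the simplices
    of the sphere, as long as they are chains. *)
Definition base_with (s : seq (nat * nat)) : {set {set 'I_N}} :=
  ladder (fun a b => (a == b) || ((a, b) \in s)).

Lemma base_sub_with s : base \subset base_with s.
Proof. by apply: ladder_sub => a b ->. Qed.

Lemma base_with_extra s :
  {in s, forall ab, [/\ ab.1 <= l, ab.2 <= l, ab.1 != ab.2 & ab.1 + ab.2 < N]%N} ->
  base_with s :\: base = [set A in [seq two_rows ab.1 ab.2 | ab <- s]].
Proof.
move=> hs; apply/setP=> A; rewrite in_setD [in RHS]in_set.
apply/andP/mapP => [[AnB /ladderP[A0 AT hA]]|[[a b] abs ->]].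
  case: hA AnB A0 AT => [[a [b [al bl /orP[e|abs] ->]]]|[p [lp ->]]] AnB A0 AT.
  - by case/negP: AnB; apply: ladder_two_rows.
  - by exists (a, b).
  - by case/negP: AnB; apply: mem_ladder_initial.
have [/= al bl ab lt] := hs _ abs; split; first exact: two_rows_notin_base.
apply: mem_ladder_two_rows => //; last by rewrite abs orbT.
by rewrite lt andbT; move: ab; case: (a) => //; case: (b).
Qed.

Lemma base_with_delta s :
  (forall a b a' b', (a == b) || ((a, b) \in s) -> (a' == b') || ((a', b') \in s) ->
     (a <= a')%N && (b <= b')%N || (a' <= a)%N && (b' <= b)%N) ->
  base_with s \in delta_faces N.
Proof. exact: ladder_delta. Qed.

Lemma leans_two_rows a b : (a <= l)%N -> (b <= l)%N -> leans_down (two_rows a b) = (a < b)%N.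
Proof. by move=> al bl; rewrite /leans_down; have [-> ->] := row_count_two_rows al bl. Qed.

Variables (k : fieldType) (char2 : 2%N \in [pchar k]%R).
Local Notation link_of := (@link_of N W base).

(** The class of the double cover of projective space by the sphere: an edge has
    value 1 when its ends have opposite signs in a lift.  A representative
    containing [base] is a lift, and the parity is that of its negative ends. *)
Definition double_cover (H : link (face W base)) : k :=
  ([exists C in val (val H), (base \subset C) && odd (down_count C)])%:R%R.

(** The value does not depend on the lift, by [down_count_act]. *)
Lemma double_coverE C : C \in delta_faces N -> base \subset C ->
  #|C :\: base| = 2%N -> double_cover (link_of C) = (down_count C)%:R%R.
Proof.
move=> dC C0C c2; rewrite /double_cover val_link_of ?base_delta // val_face //.
rewrite (natr_pchar2 (down_count C) char2); congr (nat_of_bool _)%:R%R.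
apply/exists_inP/idP => [[D]|o]; last first.
  by exists C; rewrite ?orbit_refl // C0C.
case/orbitP=> g gW eD /andP[C0D oD].
by rewrite -(down_count_act dC C0C _ C0D gW (esym eD) c2) // -eD delta_act.
Qed.

(** Each of the three vertices of a triangle lies on two of its edges, so its sign
    is counted twice. *)
Lemma double_cover_cocycle (H : link (face W base)) : (fdim H = 2)%R ->
  (\sum_(K | (K <= H)%O && (fdim K == 1)%R) double_cover K = 0)%R.
Proof.
have [C [dC C0C ->]] := link_of_surj base_delta H.
rewrite fdim_link_of ?base_delta // => e3; have {}e3 : #|C :\: base| = 3%N by lia.
have facet A : A \in C :\: base ->
    [/\ C :\ A \in delta_faces N, base \subset C :\ A & (C :\ A) :\: base = (C :\: base) :\ A].
  move=> /setDP[AC An]; split; first by apply: delta_subset dC; apply: subsetDl.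
    by rewrite subsetD1 C0C.
  by rewrite !setDDl setUC.
have card_facet A : A \in C :\: base -> #|(C :\ A) :\: base| = 2%N.
  move=> AE; have [_ _ ->] := facet A AE; have := cardsD1 A (C :\: base).
  by rewrite AE e3 => -[].
(* The edges of the triangle correspond to the omitted vertex. *)
rewrite (eq_bigl (mem [set link_of (C :\ A) | A in C :\: base])); last first.
  move=> K; apply/andP/imsetP => [[]|[A AE ->]].
    case/(link_of_below dC C0C) => D [C0D DC ->].
    rewrite fdim_link_of ?base_delta ?(delta_subset DC) // => /eqP eD.
    have cD : #|D :\: base| = 2%N by lia.
    have : #|C :\: D| = 1%N.
      have := cardsD C D; have := cardsD C base; have := cardsD D base.
      rewrite (setIidPr C0C) (setIidPr DC) (setIidPr C0D) e3 cD.
      have := subset_leq_card C0D; have := subset_leq_card DC; lia.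
    move/eqP/cards1P=> [A eA]; have := set11 A; rewrite -eA => /setDP[AC AnD].
    exists A; first by rewrite in_setD AC andbT; apply: contra AnD; apply: (subsetP C0D).
    congr link_of; rewrite -eA setDDr setDv set0U.
    by apply/esym/setIidPr.
  have [dA C0A _] := facet A AE; rewrite (link_of_le _ dC) ?subsetDl //.
  by rewrite fdim_link_of ?base_delta // card_facet.
rewrite big_imset /=; last first.
  move=> A B AE BE /(link_of_inj dC).
  have [_ C0A _] := facet A AE; have [_ C0B _] := facet B BE.
  move=> /(_ C0A C0B (subsetDl _ _) (subsetDl _ _)) /setP/(_ A).
  rewrite !in_setD1 eqxx /=; move: AE => /setDP[-> _]; rewrite andbT.
  by move/esym/negbFE/eqP.
(* Modulo 2, omitting a vertex adds its sign to the count for the triangle. *)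
rewrite (eq_bigr (fun A => (down_count C)%:R + (leans_down A)%:R)%R) => [|A AE]; last first.
  have [dA C0A eA] := facet A AE; rewrite double_coverE ?card_facet //.
  have -> : down_count C = (down_count (C :\ A) + leans_down A)%N.
    rewrite /down_count eA; move: (C :\: base) AE => E AE.
    rewrite (cardsD1 A) inE AE /= addnC; congr (_ + _)%N.
    by apply: eq_card => B; rewrite !inE andbA.
  by rewrite natrD -addrA addrr_pchar2 // addr0.
rewrite big_split /= sumr_const e3 -natr_sum.
have -> : (\sum_(A in C :\: base) leans_down A)%N = down_count C.
  by rewrite /down_count -sum1dep_card big_mkcondr; apply: eq_bigr => A _; case: leans_down.
by rewrite -mulrSr (mulrnA _ 2 2) !mulr2n !addrr_pchar2.
Qed.

Lemma base_with_below s K :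
  base_with s \in delta_faces N ->
  {in s, forall ab, [/\ ab.1 <= l, ab.2 <= l, ab.1 != ab.2 & ab.1 + ab.2 < N]%N} ->
  (fdim K = 0)%R -> (K <= link_of (base_with s)) ->
  exists2 ab, ab \in s & K = link_of (two_rows ab.1 ab.2 |: base).
Proof.
move=> ds hs fK /(link_of_below ds (base_sub_with s)) [D [C0D DC eK]].
move: fK; rewrite eK fdim_link_of ?base_delta ?(delta_subset DC) // => eD.
have /eqP/cards1P[A eA] : #|D :\: base| = 1%N by lia.
have eDA : D = A |: base by rewrite -(setID D base) (setIidPr C0D) eA setUC.
have : A \in base_with s :\: base.
  have : A \in D :\: base by rewrite eA set11.
  by rewrite !in_setD => /andP[-> /(subsetP DC)->].
rewrite (base_with_extra hs) in_set => /mapP[ab abs eA'].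
by exists ab; rewrite // eDA eA'.
Qed.

Lemma le_base_with s ab :
  base_with s \in delta_faces N ->
  {in s, forall ab, [/\ ab.1 <= l, ab.2 <= l, ab.1 != ab.2 & ab.1 + ab.2 < N]%N} ->
  ab \in s -> link_of (two_rows ab.1 ab.2 |: base) <= link_of (base_with s).
Proof.
move=> ds hs abs; have sub : two_rows ab.1 ab.2 |: base \subset base_with s.
  rewrite subUset base_sub_with andbT sub1set.
  have : two_rows ab.1 ab.2 \in base_with s :\: base.
    by rewrite (base_with_extra hs) in_set; apply: map_f.
  by rewrite in_setD => /andP[].
by rewrite (link_of_le _ ds) ?base_sub_with ?subsetUr.
Qed.

Lemma link_of_row_flip a b : (a <= l)%N -> (b <= l)%N ->
  link_of (two_rows a b |: base) = link_of (two_rows b a |: base).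
Proof.
move=> al bl; suff e : face W (two_rows a b |: base) = face W (two_rows b a |: base).
  by rewrite /link_of e.
rewrite -[LHS](face_act _ (permute_rows_wreath l (tperm r0 r1))); congr face.
rewrite -(act_two_rows al bl) -[in RHS]act_base.
exact: (imsetU1 (fun X => ('P^*)%act X row_flip)).
Qed.

(** Two lifts of edges joining columns 0 and 1, with equal and with opposite
    signs, form the cycle: their far ends are antipodal, hence equal in the
    quotient, and the double cover takes the values 0 and 1 on them. *)
Lemma wreath_complex_not_cm : ~ cohen_macaulay_complex k (quotient_complex W).
Proof.
move=> cm.
pose sp := [:: (1, 0); (2, 1)]%N; pose sm := [:: (1, 0); (1, 2)]%N.
(* A triangle, which uses the third column, bounds the dimension below. *)
pose st := [:: (1, 0); (2, 1); (3, 2)]%N.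
have N6 : (5 < N)%N by have := leq_mul l3 m2; lia.
have bound (s : seq (nat * nat)) : all (mem [:: (1, 0); (2, 1); (1, 2); (3, 2)]%N) s ->
    {in s, forall ab, [/\ ab.1 <= l, ab.2 <= l, ab.1 != ab.2 & ab.1 + ab.2 < N]%N}.
  by move=> /allP hs ab /hs; rewrite !inE => /or4P[] /eqP -> /=; split=> //; lia.
have hp := bound sp isT.
have hm := bound sm isT.
have ht := bound st isT.
have dp : base_with sp \in delta_faces N.
  by apply: base_with_delta => a b a' b'; rewrite !inE !xpair_eqE; lia.
have dm : base_with sm \in delta_faces N.
  by apply: base_with_delta => a b a' b'; rewrite !inE !xpair_eqE; lia.
have dt : base_with st \in delta_faces N.
  by apply: base_with_delta => a b a' b'; rewrite !inE !xpair_eqE; lia.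
have card_extra s : uniq [seq (ab.1 + ab.2)%N | ab <- s] ->
    {in s, forall ab, [/\ ab.1 <= l, ab.2 <= l, ab.1 != ab.2 & ab.1 + ab.2 < N]%N} ->
    #|base_with s :\: base| = size s.
  move=> us hs; rewrite base_with_extra // cardsE.
  have u : uniq [seq two_rows ab.1 ab.2 | ab <- s].
    apply: (@map_uniq _ _ (fun A : {set 'I_N} => #|A|)); rewrite -map_comp.
    suff /eq_in_map-> :
      {in s, (fun A : {set 'I_N} => #|A|) \o (fun ab => two_rows ab.1 ab.2)
         =1 (fun ab => (ab.1 + ab.2)%N)} by [].
    by move=> ab /hs[al bl _ _]; apply: card_two_rows.
  by rewrite (card_uniqP u) size_map.
have cp : #|base_with sp :\: base| = 2%N by rewrite card_extra.
have cm' : #|base_with sm :\: base| = 2%N by rewrite card_extra.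
have ct : #|base_with st :\: base| = 3%N by rewrite card_extra.
have l1 : (1 <= l)%N by lia.
have l2 : (2 <= l)%N by lia.
have np : down_count (base_with sp) = 0%N.
  rewrite /down_count base_with_extra //; apply: eq_card0 => A; rewrite in_set in_set /=.
  by rewrite !inE; apply/negP => /andP[/orP[] /eqP->]; rewrite leans_two_rows.
have nm : down_count (base_with sm) = 1%N.
  rewrite /down_count base_with_extra // -(cards1 (two_rows 1 2)).
  apply: eq_card => A; rewrite in_set in_set in_set1 /= !inE.
  apply/andP/eqP => [[/orP[] /eqP->]|->]; rewrite ?leans_two_rows //.
  by rewrite eqxx orbT.
pose Lp := link_of (base_with sp); pose Lm := link_of (base_with sm).
have fp : (fdim Lp = 1)%R by rewrite fdim_link_of ?base_delta ?base_sub_with ?cp.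
have fm : (fdim Lm = 1)%R by rewrite fdim_link_of ?base_delta ?base_sub_with ?cm'.
have lt1 : (1 < cdim (link (face W base)))%R.
  have := card_vertices_link_of W base_delta dt (base_sub_with st); rewrite ct => e.
  have : (3 <= \max_(H : link (face W base)) #|vertices H|)%N.
    by rewrite -e; apply: (leq_bigmax (F := fun H : link (face W base) => #|vertices H|)).
  by rewrite /cdim; move: (\max_(H : link (face W base)) _)%N => M; lia.
have phip : (double_cover Lp = 0)%R.
  by rewrite /Lp double_coverE ?base_sub_with ?np.
have phim : (double_cover Lm = 1)%R.
  by rewrite /Lm double_coverE ?base_sub_with ?nm.
apply: (two_cell_cycle_obstruction char2 fp fm _ _ double_cover_cocycle (cm _ _ lt1)).
  move=> K fK1; have {fK1} fK : (fdim K = 0)%R by lia.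
  apply/idP/idP => le.
    have [ab] := base_with_below dp hp fK le; rewrite !inE => /orP[] /eqP-> eK.
      by rewrite eK; exact: (le_base_with dm hm (ab := (1, 0)%N)).
    rewrite (etrans eK (link_of_row_flip l2 l1)).
    exact: (le_base_with dm hm (ab := (1, 2)%N)).
  have [ab] := base_with_below dm hm fK le; rewrite !inE => /orP[] /eqP-> eK.
    by rewrite eK; exact: (le_base_with dp hp (ab := (1, 0)%N)).
  rewrite (etrans eK (link_of_row_flip l1 l2)).
  exact: (le_base_with dp hp (ab := (2, 1)%N)).
by rewrite [X in (X + _)%R]phip [X in (_ + X)%R]phim add0r oner_eq0.
Qed.

End WreathComplex.

(** * Ideals, radicals and the Koszul complex in characteristic two *)

Section Ideals.
Variable A : comNzRingType.
Implicit Types I : A -> Prop.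

Lemma ideal_sum I (K : Type) (s : seq K) (P : pred K) (F : K -> A) :
  ideal I -> (forall k, P k -> I (F k)) -> I (\sum_(k <- s | P k) F k).
Proof.
case=> I0 ID h; elim/big_rec: _ => // k x Pk Ix.
by rewrite -[F k]mul1r; apply: ID => //; apply: h.
Qed.

Lemma ideal_add I x x' : ideal I -> I x -> I x' -> I (x + x').
Proof. by case=> _ ID Ix Ix'; rewrite -[x]mul1r; apply: ID. Qed.

Lemma ideal_mull I a x : ideal I -> I x -> I (a * x).
Proof. by case=> I0 ID Ix; rewrite -[a * x]addr0; apply: ID. Qed.

Lemma ideal_mulr I a x : ideal I -> I x -> I (x * a).
Proof. by move=> idI Ix; rewrite mulrC; apply: ideal_mull. Qed.

Lemma ideal_opp I x : ideal I -> I x -> I (- x).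
Proof. by move=> idI Ix; rewrite -mulN1r; apply: ideal_mull. Qed.

Lemma ideal_sub I x x' : ideal I -> I x -> I x' -> I (x - x').
Proof. by move=> idI Ix Ix'; apply: ideal_add => //; apply: ideal_opp. Qed.

Lemma gen_ideal_ideal (s : seq A) : ideal (gen_ideal s).
Proof.
split; first by exists (fun _ => 0); rewrite big1 // => i _; rewrite mul0r.
move=> a _ _ [c ->] [c' ->]; exists (fun i => a * c i + c' i).
rewrite mulr_sumr -big_split; apply: eq_bigr => i _ /=.
by rewrite mulrDl mulrA.
Qed.

Lemma gen_ideal_nth (s : seq A) i :
  (i < size s)%N -> gen_ideal s s`_i.
Proof.
move=> lti; exists (fun j => (j == Ordinal lti)%:R).
rewrite (bigD1 (Ordinal lti)) //= eqxx mul1r big1 ?addr0 // => j /negPf->.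
exact: mul0r.
Qed.

(** The counterpart of [gen_ideal] for families indexed by a finite type, as the
    Koszul complex and the parameters call for. *)
Definition ideal_span (J : finType) (y : J -> A) : A -> Prop :=
  fun x => exists r : J -> A, x = \sum_k r k * y k.

Lemma ideal_span_ideal (J : finType) (y : J -> A) : ideal (ideal_span y).
Proof.
split; first by exists (fun _ => 0); rewrite big1 // => i _; rewrite mul0r.
move=> a _ _ [c ->] [c' ->]; exists (fun i => a * c i + c' i).
rewrite mulr_sumr -big_split; apply: eq_bigr => i _ /=.
by rewrite mulrDl mulrA.
Qed.

Lemma ideal_span_gen (J : finType) (y : J -> A) j : ideal_span y (y j).
Proof.
exists (fun k => (k == j)%:R); rewrite (bigD1 j) //= eqxx mul1r.
by rewrite big1 ?addr0 // => k /negPf->; rewrite mul0r.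
Qed.

Definition radical I : A -> Prop := fun x => exists N, I (x ^+ N).

Lemma sub_radical I x : I x -> radical I x.
Proof. by exists 1%N; rewrite expr1. Qed.

Lemma radical_exp I x N : radical I (x ^+ N) -> radical I x.
Proof. by case=> M; rewrite -exprM; exists (N * M)%N. Qed.

Lemma radical_ideal I : ideal I -> ideal (radical I).
Proof.
move=> idI; split=> [|a x x' [N hx] [M hx']].
  by exists 1%N; rewrite expr1; case: idI.
exists (N + M)%N; rewrite exprDn; apply: ideal_sum => // i _.
rewrite -mulr_natl; apply: ideal_mull => //.
have [leM|ltM] := leqP M i.
  by rewrite -(subnK leM) exprD mulrA; apply: ideal_mull.
have leN : (N <= N + M - i)%N by rewrite -addnBA ?leq_addr // ltnW.
apply: ideal_mulr => //; rewrite exprMn; apply: ideal_mull => //.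
by rewrite -(subnK leN) exprD; apply: ideal_mull.
Qed.

End Ideals.

Section Koszul.
Variables (A : comNzRingType) (char2 : 2%N \in [pchar A]).
Variables (J : finType) (y : J -> A).
Implicit Types (I : A -> Prop) (c w z : {set J} -> A) (B : {set J}).

(** The Koszul differential on the exterior algebra with basis the subsets of [J].
    Signs are absent in characteristic two, and a chain is a function on all
    subsets: the value on sets of size [i] only involves sets of size [i + 1], so
    no grading has to be recorded. *)
Definition koszul c B : A := \sum_(i | i \notin B) y i * c (i |: B).

Lemma sum_symmetric_off_diagonal (P : pred J) (F : J -> J -> A) :
  (forall i j, F i j = F j i) ->
  \sum_(i | P i) \sum_(j | P j && (j != i)) F i j = 0.
Proof.
move=> symF; pose lt (i j : J) := (enum_rank i < enum_rank j)%N.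
have ltE i j : (j != i) = lt i j || lt j i.
  by rewrite -(inj_eq enum_rank_inj) eq_sym /lt -neq_ltn.
have [S1 S2] : (\sum_(i | P i) \sum_(j | P j && lt i j) F i j =
   \sum_(i | P i) \sum_(j | P j && lt j i) F i j) /\
   \sum_(i | P i) \sum_(j | P j && (j != i)) F i j =
   \sum_(i | P i) \sum_(j | P j && lt i j) F i j +
   \sum_(i | P i) \sum_(j | P j && lt j i) F i j.
  split.
    rewrite (exchange_big_dep P) /=; last by move=> i j _ /andP[].
    apply: eq_bigr => i Pi; apply: eq_big => [j|j _]; last exact: symF.
    by rewrite Pi.
  rewrite -big_split; apply: eq_bigr => i _ /=.
  rewrite (bigID (lt i)) /=; congr (_ + _); apply: eq_bigl => j;
    rewrite -andbA ltE /lt; case: ltngtP => //=; by rewrite ?andbT ?andbF.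
by rewrite S2 S1 addrr_pchar2.
Qed.

Lemma koszulK c B : koszul (koszul c) B = 0.
Proof.
rewrite /koszul -[RHS](@sum_symmetric_off_diagonal (fun i => i \notin B)
  (fun i j => y i * y j * c (i |: (j |: B)))); last first.
  by move=> i j; rewrite setUCA (mulrC (y i)).
apply: eq_bigr => i iB; rewrite mulr_sumr; apply: eq_big => j.
  by rewrite in_setU1 negb_or andbC.
by rewrite mulrA setUCA.
Qed.

Lemma koszul_lin a c w B :
  koszul (fun D => c D + a * w D) B = koszul c B + a * koszul w B.
Proof.
rewrite /koszul mulr_sumr -big_split; apply: eq_bigr => i _ /=.
by rewrite mulrDr mulrCA.
Qed.

Definition koszul_homotopy (r : J -> A) c B : A :=
  \sum_(k in B) r k * c (B :\ k).

(** Contraction against the coefficients of an element of the ideal of [y] is a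
    homotopy from multiplication by that element to zero: the ideal annihilates
    Koszul homology. *)
Lemma koszul_homotopyP r c B :
  koszul (koszul_homotopy r c) B + koszul_homotopy r (koszul c) B =
  (\sum_k r k * y k) * c B.
Proof.
have e1 : koszul (koszul_homotopy r c) B =
    (\sum_(i | i \notin B) r i * y i) * c B +
    \sum_(i | i \notin B) \sum_(k in B) y i * r k * c (i |: (B :\ k)).
  rewrite mulr_suml -big_split; apply: eq_bigr => i iB /=.
  rewrite /koszul_homotopy big_setU1 //= mulrDr mulr_sumr; congr (_ + _).
    by rewrite setU1K // mulrA (mulrC (y i)).
  apply: eq_bigr => k kB; rewrite mulrA; congr (_ * c _).
  apply/setP=> v; rewrite !inE; have [->|//] := eqVneq v i.
  by rewrite orTb andbT; apply: contraNneq iB => ->.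
have e2 : koszul_homotopy r (koszul c) B =
    (\sum_(k in B) r k * y k) * c B +
    \sum_(i | i \notin B) \sum_(k in B) y i * r k * c (i |: (B :\ k)).
  rewrite mulr_suml exchange_big -big_split; apply: eq_bigr => k kB /=.
  rewrite /koszul (bigD1 k) ?in_setD1 ?eqxx //= mulrDr mulr_sumr mulrA setD1K //.
  congr (_ + _); apply: eq_big => [i|i _]; last by rewrite mulrA (mulrC (r k)).
  rewrite !inE negb_and negbK; have [->|] := eqVneq i k; rewrite ?kB //.
  by rewrite andbT.
rewrite e1 e2 addrACA addrr_pchar2 // addr0 -mulrDl; congr (_ * _).
by rewrite addrC [RHS](bigID (mem B)).
Qed.

(** Exactness in degree [i] of the Koszul complex of [y] over the quotient by
    [I]. *)
Definition koszul_exact I (i : nat) : Prop :=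
  forall c, (forall B, #|B|.+1 = i -> I (koszul c B)) ->
  exists b, forall B, #|B| = i -> I (c B + koszul b B).

(** Since [f] acts nilpotently on the homology modulo [I], a nonzero homology in
    degree [i] contains a nonzero class killed by [f], and such a class comes from
    degree [i + 1] modulo [f].  Explicitly, a chain [w] bounding [f ^+ s.+1] times
    a cycle [z] is a cycle modulo [f]; correcting it by a boundary and dividing by
    [f] bounds [f ^+ s] times [z]. *)
Lemma koszul_exact_descent I f N r i :
  ideal I -> (forall x, I (f * x) -> I x) ->
  f ^+ N = \sum_k r k * y k ->
  koszul_exact (fun x => exists v, I (x + f * v)) i.+1 -> koszul_exact I i.
Proof.
move=> idI regf nilf ex z cyc.
have add2 (x : A) : x + x = 0 := addrr_pchar2 char2 x.
suff: forall s, (exists w, forall B, #|B| = i ->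
    I (f ^+ s * z B + koszul w B)) ->
    exists b, forall B, #|B| = i -> I (z B + koszul b B).
  move/(_ N); apply; exists (koszul_homotopy r z) => B cB.
  rewrite nilf -koszul_homotopyP addrC addrA add2 add0r.
  apply: ideal_sum => // k kB; apply: ideal_mull => //; apply: cyc.
  by rewrite -cB (cardsD1 k B) kB.
elim=> [|s IH] [w hw]; first by exists w => B /hw; rewrite expr0 mul1r.
apply: IH.
have [B cB|b hb] := ex w.
  exists (f ^+ s * z B).
  by rewrite addrC mulrA -exprS; apply: hw; move: cB => [].
have /fin_all_exists[v hv] : forall B, exists v, #|B| = i.+1 ->
    I (w B + koszul b B + f * v).
  move=> B; have [cB|nB] := eqVneq #|B| i.+1; last first.
    by exists 0 => cB; rewrite cB eqxx in nB.
  by have [v hv] := hb _ cB; exists v.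
exists v => B cB; apply: regf.
have : I (koszul (fun D => w D + koszul b D + f * v D) B).
  apply: ideal_sum => // k kB; apply: ideal_mull => //; apply: hv.
  by rewrite cardsU1 kB cB.
rewrite koszul_lin.
have -> : koszul (fun D => w D + koszul b D) B = koszul w B.
  have := koszul_lin 1 w (koszul b) B; rewrite koszulK mulr0 addr0 => <-.
  by rewrite /koszul; apply: eq_bigr => k _; rewrite mul1r.
move/(ideal_add idI (hw _ cB)); rewrite addrA -(addrA _ (koszul w B) (koszul w B)) add2 addr0.
by rewrite exprS -mulrA mulrDr.
Qed.

Lemma gen_ideal_rcons (s : seq A) f x :
  gen_ideal (rcons s f) x <-> exists v, gen_ideal s (x + f * v).
Proof.
have add2 (u : A) : u + u = 0 := addrr_pchar2 char2 u.
have E : size (rcons s f) = (size s).+1 by rewrite size_rcons.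
split=> [[c ->]|[v [c e]]].
  exists (c (cast_ord (esym E) ord_max)), (fun i => c (cast_ord (esym E) (widen_ord (leqnSn _) i))).
  rewrite (reindex (cast_ord (esym E))) /=; last first.
    by exists (cast_ord E) => i _; rewrite (cast_ordK, cast_ordKV).
  rewrite big_ord_recr /= nth_rcons ltnn eqxx [f * _]mulrC -addrA add2 addr0.
  by apply: eq_bigr => i _; rewrite /= nth_rcons ltn_ord.
exists (fun i => if insub (i : nat) is Some j then c j else v).
rewrite (reindex (cast_ord (esym E))) /=; last first.
  by exists (cast_ord E) => i _; rewrite (cast_ordK, cast_ordKV).
rewrite big_ord_recr /= nth_rcons ltnn eqxx.
rewrite [in insub (size s)]insubF ?ltnn //.
transitivity (\sum_(i < size s) c i * s`_i + v * f).
  by rewrite -e -addrA (mulrC f) add2 addr0.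
congr (_ + _); apply: eq_bigr => i _; rewrite nth_rcons ltn_ord.
by rewrite insubT //= => h; congr (c _ * _); apply: val_inj.
Qed.

(** Depth sensitivity of the Koszul complex.  Modulo the whole sequence there is
    nothing in degree one more than its length, because [J] is no larger; removing
    the elements of the sequence one at a time brings the degree down to 1. *)
Lemma koszul_exact_of_regular (s : seq A) :
  regular_sequence s ->
  {in s, forall f, radical (ideal_span y) f} ->
  (#|J| <= size s)%N -> koszul_exact (gen_ideal [::]) 1.
Proof.
move=> [_ reg] nil leJ.
suff: forall j, (j <= size s)%N ->
    koszul_exact (gen_ideal (take (size s - j) s)) (size s - j).+1.
  by move/(_ _ (leqnn _)); rewrite subnn take0.
elim=> [_|j IH ltj].
  rewrite subn0 => c _; exists (fun _ => 0) => B cB.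
  by have := max_card (mem B); rewrite cB leqNgt ltnS leJ.
have {IH} := IH (ltnW ltj).
have lt' : (size s - j.+1 < size s)%N by rewrite subnSK ?leq_subr.
have -> : (size s - j = (size s - j.+1).+1)%N by rewrite subnSK.
move: (size s - j.+1)%N lt' => t lt' ex.
have [N [r nilf]] := nil _ (mem_nth 0 lt').
apply: (koszul_exact_descent (gen_ideal_ideal _) _ nilf) => [x|].
  exact: reg.
move=> c cyc; have [|b hb] := ex c.
  by move=> B cB; rewrite (take_nth 0) // gen_ideal_rcons; apply: cyc.
exists b => B cB; rewrite -gen_ideal_rcons -take_nth //; exact: hb.
Qed.

(** Vanishing of the first homology says that every relation between the [y j] is
    a combination of the trivial ones; only the shape of each coefficient is
    kept. *)
Lemma relation_of_regular (s : seq A) (c : J -> A) :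
  regular_sequence s ->
  {in s, forall f, radical (ideal_span y) f} ->
  (#|J| <= size s)%N -> \sum_k c k * y k = 0 ->
  forall k, exists b : J -> A, c k = \sum_(j | j != k) b j * y j.
Proof.
move=> reg nil leJ rel k.
have nil0 (x : A) : gen_ideal [::] x -> x = 0.
  by case=> d ->; rewrite big_ord0.
pose cc (B : {set J}) := if [pick k in B] is Some k then c k else 0.
have cc1 j : cc [set j] = c j.
  rewrite /cc; case: pickP => [i|/(_ j)]; last by rewrite inE eqxx.
  by rewrite inE => /eqP->.
have [|b hb] := koszul_exact_of_regular reg nil leJ (c := cc).
  move=> B [] /eqP; rewrite cards_eq0 => /eqP->.
  suff ->: koszul cc set0 = 0 by have [] := @gen_ideal_ideal A [::].
  rewrite -rel; apply: eq_big => [i|i _]; first by rewrite inE.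
  by rewrite setU0 cc1 mulrC.
exists (fun j => b (j |: [set k])).
have := nil0 _ (hb [set k] (cards1 k)); rewrite cc1 => /eqP.
rewrite addr_eq0 oppr_pchar2 // => /eqP->.
by apply: eq_big => [j|j _]; rewrite ?inE // mulrC.
Qed.

End Koszul.

(** * Polynomials and permutation invariants *)

Section Kill.
Variables (k : fieldType) (n : nat).
Local Notation S := {mpoly k[n]}.
Implicit Types (p q : S) (t : nat).

Lemma mpoly_subalgebra_ind (P : S -> Prop) :
  (forall c, P c%:MP) -> (forall i, P 'X_i) ->
  (forall p q, P p -> P q -> P (p + q)) ->
  (forall p q, P p -> P q -> P (p * q)) -> forall p, P p.
Proof.
move=> PC PX PD PM; have P0 : P 0 by rewrite -mpolyC0.
have P1 : P 1 by rewrite -mpolyC1.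
elim/mpolyind=> // c m p _ _ Pp; apply: (PD) => //.
rewrite -mul_mpolyC; apply: (PM) => //; rewrite mpolyXE_id.
elim/big_rec: _ => // i q _ Pq; apply: (PM) => //.
by elim: (m i) => [|j IH]; rewrite ?expr0 // exprS; apply: (PM).
Qed.

(** Setting the first [t] variables to zero turns membership in the ideals generated
    by initial segments of the variables into an equation ([gen_ideal_kill]). *)
Definition kill t p : S :=
  p \mPo [tuple if (i < t)%N then 0 else 'X_i | i < n].

Lemma killX t i : kill t 'X_i = if (i < t)%N then 0 else 'X_i.
Proof. by rewrite /kill comp_mpolyXU -tnth_nth tnth_mktuple. Qed.
Lemma killC t c : kill t c%:MP = c%:MP. Proof. exact: comp_mpolyC. Qed.
Lemma killD t p q : kill t (p + q) = kill t p + kill t q.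
Proof. exact: comp_mpolyD. Qed.
Lemma killM t p q : kill t (p * q) = kill t p * kill t q.
Proof. exact: rmorphM. Qed.
Lemma kill0 t : kill t 0 = 0. Proof. exact: comp_mpoly0. Qed.
Lemma kill1 t : kill t 1 = 1. Proof. exact: comp_mpoly1. Qed.

Lemma kill_kill t u p : (t <= u)%N -> kill u (kill t p) = kill u p.
Proof.
move=> tu; elim/mpoly_subalgebra_ind: p => [c|i|p q hp hq|p q hp hq].
- by rewrite !killC.
- rewrite !killX; case: ifP => it; last by rewrite killX.
  by rewrite kill0 (leq_trans it tu).
- by rewrite !killD hp hq.
- by rewrite !killM hp hq.
Qed.

Lemma kill_all p : kill n p = (p@_0%MM)%:MP.
Proof.
elim/mpoly_subalgebra_ind: p => [c|i|p q hp hq|p q hp hq].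
- by rewrite killC mcoeffC eqxx mulr1.
- by rewrite killX ltn_ord mcoeffX mnm1_eq0 mpolyC0.
- by rewrite killD hp hq mcoeffD mpolyCD.
- by rewrite killM hp hq rmorphM mpolyCM.
Qed.

Definition variables : seq S := [seq 'X_i | i <- enum 'I_n].

Lemma size_variables : size variables = n.
Proof. by rewrite size_map size_enum_ord. Qed.

Lemma take_variables : take n variables = variables.
Proof. by rewrite take_oversize ?size_variables. Qed.

Lemma nth_variables (i : 'I_n) : variables`_i = 'X_i.
Proof. by rewrite (nth_map i) ?size_enum_ord // nth_ord_enum. Qed.

Lemma kill_congr t p : (t <= n)%N -> gen_ideal (take t variables) (p - kill t p).
Proof.
move=> le; have idI := gen_ideal_ideal (take t variables).
elim/mpoly_subalgebra_ind: p => [c|i|p q hp hq|p q hp hq].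
- by rewrite killC subrr; case: idI.
- rewrite killX; case: ifP => it; last by rewrite subrr; case: idI.
  rewrite subr0 -nth_variables -(nth_take 0 it); apply: gen_ideal_nth.
  by rewrite size_takel ?size_variables.
- by rewrite killD opprD addrACA; apply: ideal_add.
- rewrite killM.
  have -> : p * q - kill t p * kill t q = q * (p - kill t p) + kill t p * (q - kill t q).
    ring.
  by apply: ideal_add => //; apply: ideal_mull.
Qed.

Lemma gen_ideal_kill t p : (t <= n)%N ->
  gen_ideal (take t variables) p <-> kill t p = 0.
Proof.
move=> le; split=> [[c ->]|e]; last by rewrite -[p]subr0 -e; apply: kill_congr.
have -> : kill t (\sum_(i < size (take t variables)) c i * (take t variables)`_i) =
   \sum_(i < size (take t variables)) kill t (c i * (take t variables)`_i).
  exact: raddf_sum.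
apply: big1 => -[i /= lti] _; rewrite killM.
have it : (i < t)%N by move: lti; rewrite size_takel ?size_variables.
rewrite nth_take //; have lin := leq_trans it le.
by rewrite (nth_variables (Ordinal lin)) killX it mulr0.
Qed.

Lemma regular_variables : regular_sequence variables.
Proof.
split.
  move=> h; have : kill n 1 = 0.
    by apply/(gen_ideal_kill _ (leqnn n)); rewrite take_variables.
  by move/eqP; rewrite kill1 oner_eq0.
move=> i; rewrite size_variables => lti x; have le := ltnW lti.
rewrite !gen_ideal_kill // killM (nth_variables (Ordinal lti)) killX ltnn.
move/eqP; rewrite mulf_eq0 => /orP[|/eqP//].
move/eqP/(congr1 (mcoeff U_(Ordinal lti))); rewrite mcoeffX eqxx mcoeff0.
by move/eqP; rewrite oner_eq0.
Qed.

Lemma radical_of_variables (I : S -> Prop) p :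
  ideal I -> (forall i, radical I 'X_i) -> p@_0%MM = 0 -> radical I p.
Proof.
move=> idI hX p0; have := kill_congr p (leqnn n).
rewrite kill_all p0 mpolyC0 subr0 take_variables => -[c ->].
apply: ideal_sum => [|i _]; first exact: radical_ideal.
apply: ideal_mull; first exact: radical_ideal.
have lt : (i < n)%N by case: i => i /=; rewrite size_variables.
by rewrite (nth_variables (Ordinal lt)).
Qed.

End Kill.

Section Order.
Variables (k : fieldType) (n : nat).
Local Notation S := {mpoly k[n]}.
Implicit Types p q : S.

(** Order of vanishing at the origin, the substitute for the degree of
    polynomials that are not homogeneous. *)
Definition order_ge d p : Prop := forall m : 'X_{1..n}, (mdeg m < d)%N -> p@_m = 0.

Lemma order_geM a b p q : order_ge a p -> order_ge b q -> order_ge (a + b) (p * q).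
Proof.
move=> hp hq m ltm; rewrite mcoeffM; apply: big1 => -[m1 m2] /= /eqP em.
have : (mdeg m1 + mdeg m2 < a + b)%N by rewrite -mdegD -em.
have [lea|lta] := leqP a (mdeg m1); last by rewrite hp ?mul0r.
by move=> lt; rewrite hq ?mulr0 //; lia.
Qed.

Lemma order_ge_sum d (I : finType) (P : pred I) (F : I -> S) :
  (forall i, P i -> order_ge d (F i)) -> order_ge d (\sum_(i | P i) F i).
Proof. by move=> h m ltm; rewrite raddf_sum big1 // => i Pi; exact: h. Qed.

Lemma order_ge1 p : p@_0%MM = 0 -> order_ge 1 p.
Proof. by move=> p0 m; rewrite ltnS leqn0 mdeg_eq0 => /eqP->. Qed.

Lemma order_geX d p : p@_0%MM = 0 -> order_ge d (p ^+ d).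
Proof.
move=> /order_ge1 hp; elim: d => [|d IH] //.
by rewrite exprS -add1n; apply: order_geM.
Qed.

Lemma order_exists p : p != 0 -> exists d, order_ge d p /\ ~ order_ge d.+1 p.
Proof.
move=> nz; have ex : exists d, has (fun m => mdeg m == d) (msupp p).
  by exists (mdeg (mlead p)); apply/hasP; exists (mlead p); rewrite ?mlead_supp.
exists (ex_minn ex); case: ex_minnP => d /hasP[m mp /eqP em] minm; split.
  move=> m' lt; apply/eqP; apply: contraTT lt => nz'; rewrite -leqNgt.
  by apply: minm; apply/hasP; exists m'; rewrite // mcoeff_msupp.
by move=> /(_ m); rewrite em => /(_ (leqnn _)) /eqP; rewrite mcoeff_eq0 mp.
Qed.
End Order.

Section Invariants.
Variables (k : fieldType) (n : nat) (G : {group 'S_n}).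
Local Notation S := {mpoly k[n]}.
Local Notation R := (invariant_ring k G).
Implicit Types (f : R) (p q : S).

Lemma val_inv_msym f g : g \in G -> msym g (val f) = val f.
Proof. by move=> gG; apply: (invariantP _ _ (valP f)). Qed.

(** If an invariant [f] is a combination of the invariants [y j] with polynomial
    coefficients, then multiply all the conjugates of this expression: the
    product, as a polynomial in the [y j], has invariant coefficients and no
    constant term, and its value is a power of [f]. *)
Lemma radical_ideal_span_invariant (J : finType) (y : J -> R) f :
  ideal_span (fun j => val (y j)) (val f) -> radical (ideal_span y) f.
Proof.
case=> s ef; pose N := #|J|.
pose P : {mpoly S[N]} :=
  \prod_(g in G) \sum_(i < N) (msym g (s (enum_val i))) *: 'X_i.
(* Acting on the coefficients permutes the factors. *)
have Pinv m : P@_m \in Defs.invariant G.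
  apply/invariantP => h hG; rewrite -mcoeff_map_mpoly; congr (mcoeff _ _).
  rewrite /P rmorph_prod /= [RHS](reindex_inj (mulIg h)) /=.
  apply: eq_big => [g|g _]; first by rewrite groupMr.
  rewrite raddf_sum; apply: eq_bigr => i _ /=.
  by rewrite map_mpolyZ map_mpolyX msymMm.
have P0 : P@_0%MM = 0.
  rewrite /P rmorph_prod /= (bigD1 1%g) //= raddf_sum big1 ?mul0r // => i _.
  by rewrite /= mcoeffZ mcoeffX mnm1_eq0 mulr0.
pose v (i : 'I_N) : S := val (y (enum_val i)).
have Pv : P.@[v] = val f ^+ #|G|.
  rewrite /P rmorph_prod /= -prodr_const; apply: eq_bigr => g gG.
  rewrite -(val_inv_msym f gG) ef !raddf_sum /= [RHS](reindex (enum_val : 'I_N -> J)) /=.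
    apply: eq_bigr => i _.
    by rewrite mevalZ mevalXU rmorphM /= val_inv_msym.
  by exists enum_rank => i _; rewrite ?enum_rankK ?enum_valK.
pose c m : R := InvariantPoly (Pinv m).
exists #|G|.
have -> : f ^+ #|G| =
    \sum_(m <- msupp P) c m * \prod_(i < N) y (enum_val i) ^+ m i.
  apply: val_inj; rewrite rmorphXn -Pv mevalE rmorph_sum.
  apply: eq_bigr => m _; rewrite rmorphM rmorph_prod; congr (_ * _).
  by apply: eq_bigr => i _; rewrite rmorphXn.
rewrite big_seq; apply: ideal_sum => [|m mP]; first exact: ideal_span_ideal.
apply: ideal_mull; first exact: ideal_span_ideal.
have /existsP[i mi] : [exists i, m i != 0%N].
  apply: contraLR mP => /existsPn h; rewrite -mcoeff_eq0; suff -> : m = 0%MM by rewrite P0.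
  by apply/mnmP=> i; rewrite mnm0E; apply/eqP; have := h i; rewrite negbK.
rewrite (bigD1 i) //= mulrC; apply: (ideal_mull _ (ideal_span_ideal y)).
rewrite -(prednK (n := m i)) ?lt0n // exprSr.
by apply: (ideal_mull _ (ideal_span_ideal y)); apply: ideal_span_gen.
Qed.

Lemma const_invariant (c : k) : (c%:MP : S) \in Defs.invariant G.
Proof. by apply/invariantP=> g _; rewrite -[c%:MP]mulr1 mul_mpolyC msymZ msym1. Qed.

Definition augmentation f : Prop := (val f)@_0%MM = 0.

Lemma augmentation_maximal : maximal_ideal augmentation.
Proof.
split.
- split=> [|a x x' hx hx']; first exact: mcoeff0.
  rewrite /augmentation in hx hx' *.
  by rewrite !(rmorphD, rmorphM) /= [X in _ * X]hx [X in _ + X]hx' mulr0 addr0.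
- by rewrite /augmentation !rmorph1 => /eqP; rewrite oner_eq0.
move=> I idI I1 MI x Ix; apply/eqP/negP => /negP nz; apply: I1.
pose c := (val x)@_0%MM; pose C b : R := InvariantPoly (const_invariant b).
have IC : I (C c).
  have -> : C c = x - (x - C c) by ring.
  apply: ideal_sub => //; apply: MI.
  by rewrite /augmentation !rmorphB /= mcoeffC eqxx mulr1 subrr.
have -> : 1 = C c^-1 * C c; last exact: ideal_mull.
by apply: val_inj; rewrite rmorphM rmorph1 /= -mpolyCM mulVf.
Qed.

Definition kill_ideal t f : Prop := kill t (val f) = 0.

Lemma kill_prime t : prime_ideal (kill_ideal t).
Proof.
split.
- split=> [|a x x' hx hx']; first exact: kill0.
  by rewrite /kill_ideal rmorphD rmorphM killD killM hx hx' mulr0 addr0.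
- by rewrite /kill_ideal rmorph1 kill1 => /eqP; rewrite oner_eq0.
move=> x x'; rewrite /kill_ideal rmorphM killM => /eqP.
by rewrite mulf_eq0 => /orP[]/eqP; [left|right].
Qed.

Lemma mesym_invariant j : (mesym n k j : S) \in Defs.invariant G.
Proof. by apply/invariantP => g _; apply/(issymP _): g; apply: mesym_sym. Qed.

(** The primes are the traces of the ideals generated by the first variables.  They
    are separated by elementary symmetric polynomials: the one of degree [n - i]
    becomes a single monomial when [i] variables vanish, and zero when one more
    does. *)
Lemma prime_chain_augmentation : prime_chain augmentation n.
Proof.
exists kill_ideal; split=> [i _|i lti|f].
- exact: kill_prime.
- split=> [x hx|].
    by rewrite /kill_ideal -(@kill_kill _ _ i) ?leqnSn // hx kill0.
  exists (InvariantPoly (mesym_invariant (n - i))); rewrite /kill_ideal /=.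
    rewrite /mesym [kill _ _]raddf_sum; apply: big1 => h /eqP ch.
    have /exists_inP[j jh ji] : [exists j in h, (j < i.+1)%N].
      apply: contraT; rewrite negb_exists_in => /forall_inP sub.
      have /subset_leq_card : h \subset ~: [set j : 'I_n | (j < i.+1)%N].
        by apply/subsetP=> j /sub; rewrite !inE.
      by rewrite ch cardsCs setCK card_ord card_ord_ltn // leqNgt ltn_sub2l.
    by rewrite (bigD1 j) //= [comp_mpoly _ _]killM killX ji mul0r.
  (* At this point only the product of the surviving variables is nonzero. *)
  pose v (j : 'I_n) : k := (i <= j)%:R.
  have evalk p : (kill i p).@[v] = p.@[v].
    elim/mpoly_subalgebra_ind: p => [c|j|p q hp hq|p q hp hq].
    - by rewrite killC.
    - rewrite killX; case: ltnP => // ji.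
      by rewrite meval0 mevalXU /v leqNgt ji.
    - by rewrite killD !mevalD hp hq.
    - by rewrite killM !mevalM hp hq.
  move/(congr1 (meval v)); rewrite evalk meval0 /mesym raddf_sum /=.
  pose h0 : {set 'I_n} := ~: [set j : 'I_n | (j < i)%N].
  have ch0 : #|h0| = (n - i)%N.
    by rewrite cardsCs setCK card_ord card_ord_ltn // ltnW.
  rewrite (bigD1 h0) ?ch0 //= [X in _ + X]big1 ?addr0.
    rewrite rmorph_prod /= big1 => [/eqP|j]; first by rewrite oner_eq0.
    by rewrite !inE -leqNgt mevalXU /v => ->.
  move=> h /andP[/eqP ch nh]; rewrite rmorph_prod /=.
  have /exists_inP[j jh ji] : [exists j in h, (j < i)%N].
    apply: contraT; rewrite negb_exists_in => /forall_inP sub.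
    case/negP: nh.
    rewrite eqEcard ch0 ch leqnn andbT; apply/subsetP => j /sub.
    by rewrite !inE.
  by rewrite (bigD1 j) //= mevalXU /v leqNgt ji mul0r.
rewrite /kill_ideal kill_all /augmentation.
by split=> [/eqP|->]; rewrite ?mpolyC_eq0 ?mpolyC0 // => /eqP.
Qed.
End Invariants.

(** * A cohomological obstruction to the Cohen-Macaulay property *)

Section Obstruction.
Variables (k : fieldType) (char2 : 2%N \in [pchar k]).
Variables (n : nat) (G : {group 'S_n}).
Local Notation S := {mpoly k[n]}.
Local Notation R := (invariant_ring k G).

Lemma mpoly_pchar2 : 2%N \in [pchar S].
Proof. by apply: (rmorph_pchar (@mpolyC n k)). Qed.

Lemma invariant_ring_pchar2 : 2%N \in [pchar R].
Proof.
rewrite inE /=; apply/eqP; apply: val_inj; rewrite rmorph_nat rmorph0.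
by have /andP[_ /eqP] := mpoly_pchar2.
Qed.

(** The character with values [e] is a class in the first cohomology with
    polynomial coefficients; it is killed by [y j1], [y j2] and [y j3], and the
    [a i] are the cochains that witness it.  The class is nonzero because
    constants are fixed by the group, and a system of parameters of a
    Cohen-Macaulay ring of invariants cannot contain three elements that kill
    a nonzero class. *)
Lemma cohomology_obstruction (J : finType) (y : J -> R) (j1 j2 j3 : J)
    (a1 a2 a3 : S) (d : nat) :
  [/\ j1 != j2, j1 != j3 & j2 != j3] -> (#|J| <= n)%N ->
  (forall i, radical (ideal_span (fun j => val (y j))) 'X_i) ->
  (forall g, g \in G -> exists e : bool,
    [/\ msym g a1 = a1 + e%:R * val (y j1), msym g a2 = a2 + e%:R * val (y j2)
      & msym g a3 = a3 + e%:R * val (y j3)]) ->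
  (exists2 g, g \in G & msym g a1 = a1 + val (y j1)) ->
  order_ge d (val (y j1)) -> ~ order_ge d.+1 (val (y j1)) ->
  (forall j, j != j1 -> j != j2 -> order_ge d.+1 (val (y j))) ->
  ~ cohen_macaulay_ring R.
Proof.
move=> [n12 n13 n23] leJ nilX act [g0 g0G actg0] ord1 nord1 ordj [_ cm].
have add2 (p : S) : p + p = 0 := addrr_pchar2 mpoly_pchar2 p.
have [_ [[[s [reg sM <-]] _] [_ lt_h]]] := cm _ (@augmentation_maximal k n G).
have {lt_h} sizes := leq_trans leJ (lt_h _ (@prime_chain_augmentation k n G)).
have {}nil : {in s, forall f, radical (ideal_span y) f}.
  move=> f /sM f0; have [N spN] : radical (ideal_span (fun j => val (y j))) (val f).
    by apply: radical_of_variables => //; exact: ideal_span_ideal.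
  by apply: (@radical_exp _ _ _ N); apply: radical_ideal_span_invariant; rewrite rmorphXn.
pose Y j : S := val (y j).
have inv j g : g \in G -> msym g (Y j) = Y j by apply: val_inv_msym.
have uinv ja jb (a b : S) : (forall g, g \in G -> exists e : bool,
      msym g a = a + e%:R * Y ja /\ msym g b = b + e%:R * Y jb) ->
    a * Y jb + b * Y ja \in Defs.invariant G.
  move=> hab; apply/invariantP => g gG; have [e [ea eb]] := hab g gG.
  rewrite msymD !msymM !inv // ea eb.
  transitivity (a * Y jb + b * Y ja + (e%:R * (Y ja * Y jb) + e%:R * (Y ja * Y jb))).
    by ring.
  by rewrite add2 addr0.
have u12P : a1 * Y j2 + a2 * Y j1 \in Defs.invariant G.
  by apply: uinv => g /act[e [? ? ?]]; exists e.
have u13P : a1 * Y j3 + a3 * Y j1 \in Defs.invariant G.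
  by apply: uinv => g /act[e [? ? ?]]; exists e.
have u23P : a2 * Y j3 + a3 * Y j2 \in Defs.invariant G.
  by apply: uinv => g /act[e [? ? ?]]; exists e.
(* The relation between the three parameters given by the 2 by 2 minors. *)
pose c j : R := if j == j1 then InvariantPoly u23P
  else if j == j2 then InvariantPoly u13P
  else if j == j3 then InvariantPoly u12P else 0.
have cj3 : c j3 = InvariantPoly u12P.
  by rewrite /c eqxx !(eq_sym j3) (negPf n13) (negPf n23).
have relc : \sum_j c j * y j = 0.
  rewrite (bigD1 j1) // (bigD1 j2) 1?eq_sym // (bigD1 j3) /=; last first.
    by rewrite !(eq_sym j3) n13.
  rewrite cj3 /c !eqxx eq_sym (negPf n12) [X in _ + (_ + (_ + X))]big1; last first.
    by move=> j /andP[/andP[/negPf-> /negPf->] /negPf->]; rewrite mul0r.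
  apply: val_inj; rewrite !(rmorphD, rmorphM, rmorph0) /= -!/(Y _).
  transitivity (\sum_(t <- [:: a2 * Y j3 * Y j1; a3 * Y j2 * Y j1; a1 * Y j3 * Y j2]) (t + t)).
    by rewrite !big_cons big_nil; ring.
  by apply: big1 => t _; exact: add2.
have [r hr] := relation_of_regular invariant_ring_pchar2 reg nil sizes relc j3.
have {}hr : a1 * Y j2 + a2 * Y j1 = \sum_(j | j != j3) val (r j) * Y j.
  rewrite -[LHS]/(val (InvariantPoly u12P)) -cj3 hr rmorph_sum.
  by apply: eq_bigr => j _; rewrite rmorphM.
(* The same identity as a relation over S. *)
pose c' j : S := if j == j1 then a2 + val (r j1)
  else if j == j2 then a1 + val (r j2) else if j == j3 then 0 else val (r j).
have c'j2 : c' j2 = a1 + val (r j2) by rewrite /c' eqxx eq_sym (negPf n12).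
have relc' : \sum_j c' j * Y j = 0.
  rewrite (bigD1 j1) // (bigD1 j2) 1?eq_sym // (bigD1 j3) /=; last first.
    by rewrite !(eq_sym j3) n13.
  move: hr; rewrite (bigD1 j1) // (bigD1 j2) /=; last by rewrite n23 eq_sym.
  move=> {}hr.
  have e : \sum_(i | (i != j1) && (i != j2) && (i != j3)) c' i * Y i =
      \sum_(i | (i != j3) && (i != j1) && (i != j2)) val (r i) * Y i.
    apply: eq_big => [i|i]; first by rewrite andbC andbA.
    by move=> /andP[/andP[/negPf h1 /negPf h2] /negPf h3]; rewrite /c' h1 h2 h3.
  rewrite e {e} c'j2 /c' !eqxx !(eq_sym j3) (negPf n13) (negPf n23) mul0r add0r.
  rewrite -[RHS](add2 (a1 * Y j2 + a2 * Y j1)) {2}hr.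
  rewrite /=; ring.
have sizev : (#|J| <= size (variables k n))%N by rewrite size_variables.
have nilv : {in variables k n, forall f, radical (ideal_span Y) f}.
  by move=> _ /mapP[i _ ->].
have [h hh] := relation_of_regular mpoly_pchar2 (@regular_variables k n) nilv sizev relc' j2.
(* Adding its image under g0 removes the invariant r j2 and turns a1 into y j1;
   the coefficient of y j1 loses its constant term. *)
rewrite c'j2 in hh; apply: nord1.
have -> : val (y j1) = \sum_(j | j != j2) (h j + msym g0 (h j)) * Y j.
  transitivity (a1 + val (r j2) + msym g0 (a1 + val (r j2))).
    rewrite msymD actg0 val_inv_msym //.
    transitivity ((a1 + a1) + (val (r j2) + val (r j2)) + val (y j1)).
      by rewrite !add2 !add0r.
    by rewrite /=; ring.
  rewrite hh raddf_sum -big_split; apply: eq_bigr => j _ /=.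
  by rewrite msymM inv // mulrDl.
apply: order_ge_sum => j nj2; have [->|nj1] := eqVneq j j1.
  rewrite -add1n; apply: order_geM => //; apply: order_ge1.
  rewrite mcoeffD mcoeff_sym.
  have -> : [multinom 0%MM (g0 i) | i < n] = 0%MM by apply/mnmP => i; rewrite mnmE !mnm0E.
  exact: (addrr_pchar2 char2).
by rewrite -[d.+1]add0n; apply: order_geM => //; apply: ordj.
Qed.
End Obstruction.

(** * A system of parameters for the wreath product *)

Section IdealPoly.
Variables (A : comNzRingType) (I : A -> Prop).
Hypothesis idI : ideal I.

Lemma ideal_prod_congr (K : Type) (s : seq K) (P : pred K) (F H : K -> A) :
  (forall k, P k -> I (F k - H k)) ->
  I (\prod_(k <- s | P k) F k - \prod_(k <- s | P k) H k).
Proof.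
move=> h; elim/big_rec2: _ => [|k p q Pk hpq]; first by rewrite subrr; case: idI.
have -> : F k * q - H k * p = q * (F k - H k) + H k * (q - p) by ring.
by apply: ideal_add => //; apply: ideal_mull => //; apply: h.
Qed.

Lemma ideal_root (p : {poly A}) d (z : A) :
  p \is monic -> size p = d.+1 -> root p z ->
  (forall j, (j < d)%N -> I p`_j) -> I (z ^+ d).
Proof.
move=> /monicP mp sp /rootP; rewrite horner_coef sp big_ord_recr /=.
have -> : p`_d = 1 by rewrite -mp lead_coefE sp.
rewrite mul1r => /eqP; rewrite addrC addr_eq0 => /eqP-> h.
apply: ideal_opp => //; apply: ideal_sum => // j _.
by apply: (ideal_mulr _ idI); apply: h; rewrite ?ltn_ord.
Qed.
End IdealPoly.

Section Column.
Variables (A : comNzRingType) (char2 : 2%N \in [pchar A]).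
Variables (m : nat) (z : 'I_m -> A).

Definition column_poly : {poly A} := \prod_i ('X - (z i)%:P).

Lemma column_poly_monic : column_poly \is monic.
Proof. exact: monic_prod_XsubC. Qed.

Lemma size_column_poly : size column_poly = m.+1.
Proof. by rewrite /column_poly -big_enum size_prod_XsubC size_enum_ord. Qed.

Lemma root_column_poly i : root column_poly (z i).
Proof.
by rewrite /root horner_prod (bigD1 i) //= hornerXsubC subrr mul0r.
Qed.

Definition vandermonde : A := \prod_(i < m) \prod_(i' < m | (i < i')%N) (z i' - z i).

(** The sum of the diagonal term and its conjugates by even permutations; in
    characteristic two it and its conjugate by an odd permutation add up to the
    Vandermonde product. *)
Definition even_half : A :=
  \sum_(s : 'S_m | ~~ odd_perm s) \prod_i z (s i) ^+ i.

(** The Vandermonde determinant is equal to the permanent in characteristic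
    two. *)
Lemma vandermondeE : vandermonde = \sum_(s : 'S_m) \prod_i z (s i) ^+ i.
Proof.
have := det_Vandermonde (\row_i z i); rewrite /determinant => e.
transitivity (\prod_(i < m) \prod_(j < m | (i < j)%N)
   ((\row_i z i) 0 j - (\row_i z i) 0 i)).
  by apply: eq_bigr => i _; apply: eq_bigr => j _; rewrite !mxE.
rewrite -e; apply: eq_bigr => s _.
have -> : (-1) ^+ s = 1 :> A by rewrite oppr_pchar2 // expr1n.
by rewrite mul1r; apply: eq_bigr => i _; rewrite !mxE.
Qed.

Lemma deriv_column_poly i : column_poly^`().[z i] = \prod_(i' | i' != i) (z i - z i').
Proof.
rewrite /column_poly (bigD1 i) //= derivM derivXsubC mul1r hornerD hornerM hornerXsubC.
rewrite subrr mul0r addr0 horner_prod.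
by apply: eq_bigr => j _; rewrite hornerXsubC.
Qed.

Lemma prod_deriv_column_poly : exists b,
  \prod_i column_poly^`().[z i] = b * vandermonde.
Proof.
exists (\prod_(i < m) \prod_(i' < m | (i < i')%N) (z i - z i')).
rewrite /vandermonde [X in _ * X](exchange_big_dep xpredT) //=.
rewrite -big_split; apply: eq_bigr => i _ /=; rewrite deriv_column_poly.
rewrite (bigID (fun i' : 'I_m => (i < i')%N)) /=; congr (_ * _);
  by apply: eq_bigl => j; rewrite -(inj_eq val_inj) /=; case: ltngtP.
Qed.

(** Let [f] be the polynomial with roots [z i].  If all its coefficients below
    the leading one but one vanish, so that [f] is X^m + c (odd [m]) or
    X^m + c X (even [m]), then the value of the derivative of [f] at a root is a
    power of this root, for odd [m], or [c], for even [m].  The product of these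
    values is divisible by the Vandermonde product and is, up to sign, a power
    of [c].  So [c] vanishes with the Vandermonde product, and with it all the
    roots.  Here vanishing means lying in the radical of [I]. *)
Lemma column_nilpotent (I : A -> Prop) i :
  ideal I -> (1 < m)%N -> radical I vandermonde ->
  (forall j, (j < m)%N -> j != ~~ odd m :> nat -> radical I column_poly`_j) ->
  radical I (z i).
Proof.
move=> idI m_gt1 hD hf; have idR := radical_ideal idI.
set f := column_poly in hf *; pose i0 : nat := ~~ odd m.
have fm : f`_m = 1.
  by have /monicP := column_poly_monic; rewrite lead_coefE size_column_poly.
have nat2 (j : nat) : j%:R = (odd j)%:R :> A by apply: natr_pchar2.
have hprod : radical I (\prod_i f^`().[z i]).
  by have [b ->] := prod_deriv_column_poly; apply: ideal_mull.
have fi0 : radical I f`_i0.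
  have derivE j : radical I (f^`().[z j] - (if odd m then z j ^+ m.-1 else f`_1)).
    rewrite (@horner_coef_wide _ m); last first.
      by rewrite -ltnS -size_column_poly lt_size_deriv // monic_neq0 // column_poly_monic.
    have term t : (t.+1 < m)%N -> t.+1 != i0 -> radical I (f^`()`_t * z j ^+ t).
      move=> lt ne; rewrite coef_deriv -mulr_natl -mulrA mulrCA.
      by apply: (ideal_mulr _ idR); apply: hf.
    have m_gt0 := ltnW m_gt1.
    case om: (odd m).
      have ltl : (m.-1 < m)%N by rewrite prednK.
      rewrite (bigD1 (Ordinal ltl)) //= coef_deriv prednK // fm nat2 om mul1r.
      rewrite addrAC subrr add0r; apply: ideal_sum => // t nt.
      apply: term; last by rewrite /i0 om.
      by have := ltn_ord t; have : t != m.-1 :> nat; [exact: nt | lia].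
    rewrite (bigD1 (Ordinal m_gt0)) //= coef_deriv expr0 mulr1 mulr1n.
    rewrite addrAC subrr add0r; apply: ideal_sum => // t nt.
    have t_gt0 : (0 < t)%N by rewrite lt0n; exact: nt.
    have [lt|ge] := ltnP t.+1 m; first by apply: term; rewrite // /i0 om; lia.
    have -> : f^`()`_t = 0.
      have e : t.+1 = m by apply/eqP; rewrite eqn_leq ge ltn_ord.
      by rewrite coef_deriv e fm nat2 om.
    by rewrite mul0r; case: idR.
  have := ideal_prod_congr idR (index_enum 'I_m) (P := xpredT) (fun j _ => derivE j).
  move/(ideal_sub idR hprod); rewrite opprB addrC subrK.
  rewrite /i0; case om: (odd m) => /=; last first.
    by rewrite prodr_const card_ord => /radical_exp.
  rewrite prodrXl => /radical_exp.
  rewrite -horner_coef0 horner_prod; congr (radical I _).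
  by apply: eq_bigr => j _; rewrite hornerXsubC sub0r oppr_pchar2.
have /radical_exp : radical I (z i ^+ m); last by [].
apply: (ideal_root idR column_poly_monic size_column_poly (root_column_poly i)).
by move=> j jm; have [->|nj] := eqVneq j i0; [|apply: hf].
Qed.

End Column.

Lemma msymXU (k : fieldType) n (g : 'S_n) (v : 'I_n) :
  msym g ('X_v : {mpoly k[n]}) = 'X_(g v).
Proof.
rewrite msymX; congr 'X_[_]; apply/mnmP=> i; rewrite mnmE !mnm1E.
by rewrite -(inj_eq (@perm_inj _ g)) permKV.
Qed.

Section WreathRing.
Variables (k : fieldType) (char2 : 2%N \in [pchar k]) (l m : nat).
Local Notation S := {mpoly k[(l * m)%N]}.
Local Notation W := (wreath l m).
Implicit Types (i : 'I_m) (j : 'I_l) (s : 'S_m) (g : 'S_(l * m)).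

Let char2S : 2%N \in [pchar S] := mpoly_pchar2 char2 (l * m).

(** The coefficients of this polynomial are the elementary symmetric functions of a
    row up to sign.  The wreath product permutes them through the rows only. *)
Definition row_poly i : {poly S} :=
  \prod_(v : 'I_(l * m) | row_of v == i) ('X - ('X_v)%:P).

Definition row_coef j i : S := (row_poly i)`_j.

Lemma row_poly_monic i : row_poly i \is monic.
Proof. exact: monic_prod_XsubC. Qed.

Lemma size_row_poly i : size (row_poly i) = l.+1.
Proof.
rewrite /row_poly -big_filter size_prod_XsubC -[in RHS](card_row l i) cardsE cardE.
by rewrite /enum_mem.
Qed.

Lemma root_row_poly v : root (row_poly (row_of v)) 'X_v.
Proof.
by rewrite /row_poly (bigD1 v (eqxx (row_of v))) /= rootM root_XsubC eqxx.
Qed.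

Lemma msym_row_coef g s j i : (forall v, row_of (g v) = s (row_of v)) ->
  msym g (row_coef j i) = row_coef j (s i).
Proof.
move=> gs; rewrite /row_coef -coef_map; congr (polyseq _)`_j.
rewrite /row_poly rmorph_prod [RHS](reindex_inj (@perm_inj _ g)).
apply: eq_big => [v|v _]; first by rewrite gs (inj_eq perm_inj).
by rewrite rmorphB /= map_polyX map_polyC /= msymXU.
Qed.

Lemma row_coef_constant j i : (row_coef j i)@_0%MM = 0.
Proof.
rewrite /row_coef -coef_map rmorph_prod /=.
rewrite (eq_bigr (fun _ => 'X)) => [|v _]; last first.
  by rewrite rmorphB /= map_polyX map_polyC /= mcoeffX mnm1_eq0 subr0.
have := card_row l i; rewrite prodr_const cardsE => ->.
by rewrite coefXn ltn_eqF.
Qed.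

(** The constant coefficient is the product of the variables of a row; evaluate at
    0 on one row and at 1 on the others. *)
Lemma row_coef_inj j : j = 0%N :> nat -> injective (row_coef j).
Proof.
move=> j0 i i' e; apply/eqP/negPn/negP => ne.
pose e0 (v : 'I_(l * m)) : k := (row_of v != i)%:R.
have E t : (row_coef j t).@[e0] = \prod_(v | row_of v == t) (e0 v).
  rewrite /row_coef j0 -horner_coef0 horner_prod rmorph_prod.
  apply: eq_bigr => v _.
  by rewrite hornerXsubC sub0r (oppr_pchar2 char2S) /= mevalXU.
have := congr1 (meval e0) e; rewrite !E.
have l_gt0 : (0 < l)%N by apply: leq_ltn_trans (ltn_ord j).
rewrite (bigD1 (cell i (Ordinal l_gt0))) ?row_cell //= {1}/e0 row_cell eqxx mul0r.
rewrite big1 => [/esym/eqP|v /eqP vi']; first by rewrite oner_eq0.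
by rewrite /e0 vi' eq_sym ne.
Qed.

Definition column_invariant j i : S := (column_poly (row_coef j))`_i.

Lemma column_invariantP j i : column_invariant j i \in Defs.invariant W.
Proof.
apply/invariantP => g gW; have [s gs] := wreath_row_perm (leq_ltn_trans (leq0n j) (ltn_ord j)) gW.
rewrite /column_invariant -coef_map; congr (polyseq _)`_i.
rewrite /column_poly rmorph_prod [RHS](reindex_inj (@perm_inj _ s)).
apply: eq_bigr => t _.
by rewrite rmorphB /= map_polyX map_polyC /= (msym_row_coef _ _ gs).
Qed.

Lemma column_invariant_constant j i : (column_invariant j i)@_0%MM = 0.
Proof.
rewrite /column_invariant -coef_map rmorph_prod /=.
rewrite (eq_bigr (fun _ => 'X)) => [|v _]; last first.
  by rewrite rmorphB /= map_polyX map_polyC /= row_coef_constant subr0.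
by rewrite prodr_const card_ord coefXn ltn_eqF.
Qed.

(** [half j] is a cochain bounding [delta j] times the sign character. *)
Definition delta j : S := vandermonde (row_coef j).
Definition half j : S := even_half (row_coef j).

Lemma msym_half g s j : (forall v, row_of (g v) = s (row_of v)) ->
  msym g (half j) = half j + (odd_perm s)%:R * delta j.
Proof.
move=> gs; have e : msym g (half j) =
    \sum_(t : 'S_m | odd_perm t == odd_perm s) \prod_i row_coef j (t i) ^+ i.
  rewrite raddf_sum [RHS](reindex_inj (mulIg s)) /=.
  apply: eq_big => [t|t _]; first by rewrite odd_permM; case: odd_perm; case: odd_perm.
  rewrite rmorph_prod; apply: eq_bigr => i _.
  by rewrite rmorphXn /= (msym_row_coef _ _ gs) permM.
rewrite e /half /delta vandermondeE // /even_half; case: (odd_perm s).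
  rewrite mul1r [X in _ + X](bigID (fun t : 'S_m => ~~ odd_perm t)) /= addrA.
  rewrite (addrr_pchar2 char2S) add0r; apply: eq_bigl => t.
  by rewrite negbK; case: odd_perm.
by rewrite mul0r addr0; apply: eq_bigl => t; case: odd_perm.
Qed.

Lemma deltaP j : delta j \in Defs.invariant W.
Proof.
apply/invariantP => g gW; have [s gs] := wreath_row_perm (leq_ltn_trans (leq0n j) (ltn_ord j)) gW.
rewrite /delta vandermondeE // raddf_sum [RHS](reindex_inj (mulIg s)) /=.
apply: eq_bigr => t _.
rewrite rmorph_prod; apply: eq_bigr => i _.
by rewrite rmorphXn /= (msym_row_coef _ _ gs) permM.
Qed.

Lemma delta_constant j : (1 < m)%N -> (delta j)@_0%MM = 0.
Proof.
move=> m_gt1; rewrite /delta /vandermonde rmorph_prod.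
rewrite (bigD1 (Ordinal (ltnW m_gt1))) //= rmorph_prod.
rewrite (bigD1 (Ordinal m_gt1)) //= rmorphB /= !row_coef_constant subrr.
by rewrite !mul0r.
Qed.

Lemma delta_neq0 j : j = 0%N :> nat -> delta j != 0.
Proof.
move=> j0; apply/prodf_neq0 => i _; apply/prodf_neq0 => i' lt.
rewrite subr_eq0 (inj_eq (row_coef_inj j0)) -(inj_eq val_inj) /=.
by rewrite gtn_eqF.
Qed.

(** The coefficients of the column polynomials are a system of parameters.  In each
    of the first three columns the coefficient isolated in [column_nilpotent] is
    replaced by the Vandermonde product.  The exponents raise the order at the
    origin of all parameters but two above [d]; the power of [delta] in column 2
    is killed by the sign character like [delta] itself. *)
Definition parameter (d : nat) (ij : 'I_m * 'I_l) : S :=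
  if (ij.1 == (~~ odd m) :> nat) && (ij.2 < 3)%N
  then if ij.2 == 2%N :> nat then delta ij.2 ^+ d.+1 else delta ij.2
  else column_invariant ij.2 ij.1 ^+ d.+1.

Lemma parameterP d ij : parameter d ij \in Defs.invariant W.
Proof.
have invX p c : p \in Defs.invariant W -> p ^+ c \in Defs.invariant W.
  by move=> pI; apply/invariantP => g gW; rewrite rmorphXn /= (invariantP _ _ pI).
rewrite /parameter; case: ifP => _; last exact/invX/column_invariantP.
by case: ifP => _; [apply/invX/deltaP|apply: deltaP].
Qed.

(** Variables are roots of row polynomials, and row coefficients are roots of column
    polynomials: nilpotency goes up from the parameters in two steps. *)
Lemma parameter_radical d (v : 'I_(l * m)) : (1 < m)%N ->
  radical (ideal_span (parameter d)) 'X_v.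
Proof.
move=> m_gt1; set I := ideal_span _.
have idI : ideal I := ideal_span_ideal _; have idR := radical_ideal idI.
have hcol j i : radical I (row_coef j i).
  have hc (t : 'I_m) : ~~ ((t == (~~ odd m) :> nat) && (j < 3)%N) ->
      radical I (column_invariant j t).
    move=> /negPf h; apply: (@radical_exp _ _ _ d.+1); apply: sub_radical.
    by have := ideal_span_gen (parameter d) (t, j); rewrite /parameter /= h.
  have [j3|j3] := ltnP j 3.
    apply: (column_nilpotent char2S) => // [|t ltm nt].
      have lt : (~~ odd m < m)%N by case: (odd m) => //; apply: ltnW.
      apply: (@radical_exp _ _ _ (if j == 2%N :> nat then d.+1 else 1)); apply: sub_radical.
      have := ideal_span_gen (parameter d) (Ordinal lt, j).
      by rewrite /parameter /= eqxx j3 /=; case: ifP; rewrite ?expr1.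
    by apply: (hc (Ordinal ltm)); rewrite /= (negPf nt).
  have := ideal_root idR (column_poly_monic _) (size_column_poly _)
    (root_column_poly (row_coef j) i).
  move=> h; apply: (@radical_exp _ _ _ m); apply: h => t ltm.
  by apply: (hc (Ordinal ltm)); rewrite ltnNge j3 andbF.
have := ideal_root idR (row_poly_monic _) (size_row_poly _) (root_row_poly v).
move=> h; apply: (@radical_exp _ _ _ l); apply: h => t ltl.
exact: (hcol (Ordinal ltl)).
Qed.

(** Column 0 is where the Vandermonde product is known to be nonzero; [d] is its
    order at the origin. *)
Lemma wreath_ring_not_cm : (2 < l)%N -> (1 < m)%N ->
  ~ cohen_macaulay_ring (invariant_ring k W).
Proof.
move=> l3 m_gt1.
pose c0 : 'I_l := Ordinal (ltn_trans (isT : 0 < 2)%N l3).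
pose c1 : 'I_l := Ordinal (ltn_trans (isT : 1 < 2)%N l3).
pose c2 : 'I_l := Ordinal l3.
have [d [ord1 nord1]] := order_exists (delta_neq0 (erefl : c0 = 0%N :> nat)).
have lt0 : (~~ odd m < m)%N by case: (odd m) => //; apply: ltnW.
pose t0 : 'I_m := Ordinal lt0.
pose y ij : invariant_ring k W := InvariantPoly (parameterP d ij).
have y0 : val (y (t0, c0)) = delta c0 by rewrite /= /parameter /= eqxx.
have y1 : val (y (t0, c1)) = delta c1 by rewrite /= /parameter /= eqxx.
have y2 : val (y (t0, c2)) = delta c2 * delta c2 ^+ d.
  by rewrite /= /parameter /= eqxx /= exprS.
apply: (@cohomology_obstruction k char2 _ _ _ y (t0, c0) (t0, c1) (t0, c2)
  (half c0) (half c1) (half c2 * delta c2 ^+ d) d).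
- by split; rewrite xpair_eqE eqxx.
- by rewrite card_prod !card_ord mulnC.
- by move=> v; apply: parameter_radical.
- move=> g gW; have [s gs] := wreath_row_perm (leq_ltn_trans (leq0n _) l3) gW.
  exists (odd_perm s); rewrite y0 y1 y2 msymM rmorphXn /= !(msym_half _ gs).
  by rewrite (invariantP _ _ (deltaP c2)) //; split=> //; ring.
- pose r0 : 'I_m := Ordinal (ltnW m_gt1); pose r1 : 'I_m := Ordinal m_gt1.
  exists (permute_rows l (tperm r0 r1)); first exact: permute_rows_wreath.
  by rewrite y0 (msym_half _ (@row_permute_rows l m (tperm r0 r1))) odd_tperm mul1r.
- by rewrite y0.
- by rewrite y0.
move=> [i j] n0 n1; rewrite /= /parameter /=; case: ifP => [/andP[it j3]|_].
  have ei : i = t0 by apply: val_inj; exact/eqP.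
  case: ifP => [_|j2]; first by apply/order_geX/delta_constant.
  move: n0 n1; rewrite ei !xpair_eqE eqxx /= -!(inj_eq val_inj) /=.
  by case: j j3 j2 {it ei} => -[|[|[|?]]].
exact/order_geX/column_invariant_constant.
Qed.
End WreathRing.

Theorem proposition3p1 (l m : nat) (hl : (2 < l)%N) (hm : (1 < m)%N) :
  ~ cohen_macaulay_complex 'F_2 (quotient_complex (wreath l m)) /\
  ~ cohen_macaulay_ring (invariant_ring 'F_2 (wreath l m)).
Proof.
have char2 : 2%N \in [pchar 'F_2] by exact: pchar_Fp.
split; first exact: (wreath_complex_not_cm hl hm char2).
exact: (wreath_ring_not_cm char2 hl hm).
Qed.
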